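(* Let $q$ be a nonzero complex number with $|q|<1$. Then \begin{align*} \mathfrak{g}_{1,2,1,2,2,1}(q^3,q^3,q^3,q)&=0,\\ \mathfrak{g}_{1,2,1,2,2,1}(q,q,q^2,q)&=J_{1}^2,\\ \mathfrak{g}_{1,2,1,2,2,1}(q,q^2,q^2,q)&=J_{1}^2\,\chi_0(q),\\ \mathfrak{g}_{1,2,1,2,2,1}(q,q,q^3,q)&=J_1^2\,(q\chi_0(q)+1-q),\\ \mathfrak{g}_{1,2,1,2,2,1}(q,q^2,q^3,q)&=J_1^{2}\,(q\chi_1(q)+1). \end{align*}
   Context: For positive integers $a,b,c,d,e,f$ and $x,y,z\in\mathbb{C}\setminus\{0\}$, the triple-sum is $$\mathfrak{g}_{a,b,c,d,e,f}(x,y,z,q):=\Big(\sum_{r,s,t\ge 0}+\sum_{r,s,t<0}\Big)(-1)^{r+s+t}x^{r}y^{s}z^{t}q^{a\binom{r}{2}+brs+c\binom{s}{2}+drt+est+f\binom{t}{2}},$$ where the sums run over integers $r,s,t$ and $\binom{n}{2}=n(n-1)/2$ for all $n\in\mathbb{Z}$. Notation: $(x)_n:=\prod_{i=0}^{n-1}(1-q^ix)$ and $J_m:=\prod_{i=1}^{\infty}(1-q^{mi})$ (so $J_1=\prod_{i\ge1}(1-q^i)$). The fifth order mock theta functions are $$\chi_0(q):=\sum_{n\ge 0}\frac{q^n}{(q^{n+1})_n},\qquad \chi_1(q):=\sum_{n\ge 0}\frac{q^n}{(q^{n+1})_{n+1}}.$$ *)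

(* Defs.v *)
From Stdlib Require Import Reals ZArith List.
From Coquelicot Require Import Coquelicot.
Import ListNotations.
Open Scope C_scope.

Definition Csum_list {I : Type} (f : I -> C) (L : list I) : C :=
  fold_right Cplus (RtoC 0) (map f L).

Fixpoint Cprod (u : nat -> C) (n : nat) : C :=
  match n with
  | O => RtoC 1
  | S k => Cprod u k * u k
  end.

(** For [z = 0] and [n < 0] this is a junk value; only used with [z <> 0]. *)

Definition Cpowz (z : C) (n : Z) : C :=
  match n with
  | Z0 => RtoC 1
  | Zpos p => z ^ Pos.to_nat p
  | Zneg p => / z ^ Pos.to_nat p
  end.

Definition binom2 (n : Z) : Z := (n * (n - 1) / 2)%Z.

(** Unordered (unconditional) summation over the index set [P]: the finite
    subsets of [P], represented by duplicate-free lists, are directed by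
    inclusion.  For complex families this is absolute convergence, so the value
    does not depend on how a multiple sum is arranged.  The lower bound [L0]
    must itself lie in [P], otherwise no [L] would be above it. *)

Definition finite_subsets {I : Type} (P : I -> Prop) : (list I -> Prop) -> Prop :=
  fun Q => exists L0 : list I, List.Forall P L0 /\
    forall L : list I, NoDup L -> List.Forall P L -> incl L0 L -> Q L.

Definition is_sum_over {I : Type} (P : I -> Prop) (f : I -> C) (l : C) : Prop :=
  filterlim (Csum_list f) (finite_subsets P) (locally l).

Definition g_term (a b c d e f : Z) (x y z q : C) (i : Z * Z * Z) : C :=
  let '(r, s, t) := i in
  Cpowz (- RtoC 1) (r + s + t) * Cpowz x r * Cpowz y s * Cpowz z t *
  Cpowz q (a * binom2 r + b * r * s + c * binom2 s
           + d * r * t + e * s * t + f * binom2 t).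

Definition octant_nonneg (i : Z * Z * Z) : Prop :=
  let '(r, s, t) := i in (0 <= r)%Z /\ (0 <= s)%Z /\ (0 <= t)%Z.

Definition octant_neg (i : Z * Z * Z) : Prop :=
  let '(r, s, t) := i in (r < 0)%Z /\ (s < 0)%Z /\ (t < 0)%Z.

(** [is_g a b c d e f x y z q l]: both sums converge and their total is [l];
    meant for positive [a, ..., f] and nonzero [x, y, z, q]. *)
Definition is_g (a b c d e f : Z) (x y z q l : C) : Prop :=
  exists l1 l2 : C,
    is_sum_over octant_nonneg (g_term a b c d e f x y z q) l1 /\
    is_sum_over octant_neg (g_term a b c d e f x y z q) l2 /\
    l = l1 + l2.

Definition qpoch (q x : C) (n : nat) : C :=
  Cprod (fun i => RtoC 1 - q ^ i * x) n.

(** [J_m] is the limit of its partial products; the factor of index [k] is the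
    one for [i = k + 1]. *)
Definition is_J (m : nat) (q l : C) : Prop :=
  filterlim (Cprod (fun k => RtoC 1 - q ^ (m * S k))) eventually (locally l).

Definition is_chi0 (q l : C) : Prop :=
  is_series (fun n : nat => q ^ n / qpoch q (q ^ (n + 1)) n) l.

Definition is_chi1 (q l : C) : Prop :=
  is_series (fun n : nat => q ^ n / qpoch q (q ^ (n + 1)) (n + 1)) l.

(* Main.v *)
Require Import Defs.
From Stdlib Require Import Reals ZArith List Lra Lia Permutation Classical.
From Stdlib Require Import ClassicalEpsilon.
From Coquelicot Require Import Coquelicot.
Import ListNotations.
Open Scope C_scope.

(** The substitution [n -> -1-n] in all three indices maps the octant of
    negative indices onto the other one.  When the arguments are [q^i], [q^j],
    [q^k] it replaces [(i, j, k)] by [(6-i, 6-j, 6-k)], up to the factor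
    [-q^(9-i-j-k)], so that every value of the triple sum is a difference of two
    sums over [nat^3] ([is_g_octants]).  For [i = j = k = 3] the two sums
    coincide, whence the value 0.

    Splitting off the terms whose last index is 0 shifts the exponents
    ([triple_sum_shift], [double_sum_shift]).  With the symmetry of the triple
    sum this reduces the other four values to three evaluations: a double sum
    equal to [J^2] ([double_sum_identity]), and one triple sum for each mock
    theta function ([chi0_triple_sum], [chi1_triple_sum]).

    These three are instances of Bailey's method.  The terms with [r + s = R]
    are collected into one coefficient.  The remaining sum over [t] is a partial
    theta function, and
    [theta (N+1) = J^2 * sum_m q^m / ((q)_m (q)_(m+N))] ([theta_heine]).
    Collecting the resulting terms by [n = R + m] gives
    [J^2 * sum_n q^n * sum_(R <= n) a_R / ((q)_(n-R) (q)_(n+R+c))]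
    ([bailey_transform]), where [c = 0] belongs to [chi0] and [c = 1] to [chi1].
    The inner sum equals [(q)_n / (q)_(2n+c)] ([even_bailey_pair],
    [odd_bailey_pair]), which makes the outer one the series of a mock theta
    function.  The evaluation of the double sum is the limit of the same finite
    identity as [n] grows ([bailey_limit]).

    The finite identity is proved by climbing from [2n] to [2n+1] to [2n+2] with
    the two forms of the q-Pascal rule.  The coefficients [a_R] arise by folding
    a family [ecoef] on all of [Z], which the map [z -> -2-z] reflects up to a
    factor.  In the first step the error term is antisymmetric, and in the
    second it cancels pair by pair, by the two-step recurrence of the sums
    [inner m] of [q^(s (m-1-s))] over [s < m].

    All rearrangements take place in families dominated by geometric ones, and
    all of them follow from one theorem on unordered sums,
    [is_sum_over_fibers]. *)

(** * Finite sums over lists *)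

Lemma Csum_cons {I} (f : I -> C) x L :
  Csum_list f (x :: L) = f x + Csum_list f L.
Proof. reflexivity. Qed.

Lemma Csum_app {I} (f : I -> C) L M :
  Csum_list f (L ++ M) = Csum_list f L + Csum_list f M.
Proof.
  induction L as [|x L IH]; simpl.
  - unfold Csum_list at 2; simpl; ring.
  - rewrite !Csum_cons, IH; ring.
Qed.

Lemma Csum_perm {I} (f : I -> C) L M :
  Permutation L M -> Csum_list f L = Csum_list f M.
Proof.
  induction 1; rewrite ?Csum_cons in *; try congruence; ring.
Qed.

Lemma Csum_map {I J} (h : I -> J) (f : J -> C) L :
  Csum_list f (map h L) = Csum_list (fun i => f (h i)) L.
Proof. unfold Csum_list; now rewrite map_map. Qed.

Lemma Csum_ext {I} (f g : I -> C) L :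
  (forall i, In i L -> f i = g i) -> Csum_list f L = Csum_list g L.
Proof. intros H; unfold Csum_list; now rewrite (map_ext_in _ _ _ H). Qed.

Lemma Csum_plus {I} (f g : I -> C) L :
  Csum_list (fun i => f i + g i) L = Csum_list f L + Csum_list g L.
Proof.
  induction L as [|x L IH]; [unfold Csum_list; simpl; ring|].
  rewrite !Csum_cons, IH; ring.
Qed.

Lemma Csum_scal {I} (c : C) (f : I -> C) L :
  Csum_list (fun i => c * f i) L = c * Csum_list f L.
Proof.
  induction L as [|x L IH]; [unfold Csum_list; simpl; ring|].
  rewrite !Csum_cons, IH; ring.
Qed.

Definition Rsum_list {I} (u : I -> R) (L : list I) : R :=
  fold_right Rplus 0%R (map u L).

Lemma Rsum_cons {I} (u : I -> R) x L :
  Rsum_list u (x :: L) = (u x + Rsum_list u L)%R.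
Proof. reflexivity. Qed.

Lemma Rsum_app {I} (u : I -> R) L M :
  Rsum_list u (L ++ M) = (Rsum_list u L + Rsum_list u M)%R.
Proof.
  induction L as [|x L IH]; simpl.
  - unfold Rsum_list at 2; simpl; ring.
  - rewrite !Rsum_cons, IH; ring.
Qed.

Lemma Rsum_perm {I} (u : I -> R) L M :
  Permutation L M -> Rsum_list u L = Rsum_list u M.
Proof. induction 1; rewrite ?Rsum_cons in *; lra. Qed.

Lemma Rsum_map {I J} (h : I -> J) (u : J -> R) L :
  Rsum_list u (map h L) = Rsum_list (fun i => u (h i)) L.
Proof. unfold Rsum_list; now rewrite map_map. Qed.

Lemma Rsum_le {I} (u v : I -> R) L :
  (forall i, u i <= v i)%R -> (Rsum_list u L <= Rsum_list v L)%R.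
Proof.
  intros H; induction L as [|x L IH]; [apply Rle_refl|].
  rewrite !Rsum_cons; specialize (H x); lra.
Qed.

Lemma Rsum_scal {I} (c : R) (u : I -> R) L :
  Rsum_list (fun i => c * u i)%R L = (c * Rsum_list u L)%R.
Proof.
  induction L as [|x L IH]; [unfold Rsum_list; simpl; ring|].
  rewrite !Rsum_cons, IH; ring.
Qed.

Lemma Rsum_nonneg {I} (u : I -> R) L :
  (forall i, 0 <= u i)%R -> (0 <= Rsum_list u L)%R.
Proof.
  intros H; induction L as [|x L IH]; [apply Rle_refl|].
  rewrite Rsum_cons; specialize (H x); lra.
Qed.

Lemma Rsum_prod {I J} (u : I -> R) (v : J -> R) L M :
  Rsum_list (fun p => u (fst p) * v (snd p))%R (list_prod L M)
  = (Rsum_list u L * Rsum_list v M)%R.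
Proof.
  induction L as [|x L IH]; simpl; [unfold Rsum_list; simpl; ring|].
  rewrite Rsum_app, IH, Rsum_cons, Rsum_map; simpl.
  rewrite Rsum_scal; ring.
Qed.

Lemma Cmod_Csum {I} (f : I -> C) L :
  (Cmod (Csum_list f L) <= Rsum_list (fun i => Cmod (f i)) L)%R.
Proof.
  induction L as [|x L IH].
  - unfold Csum_list; simpl; rewrite Cmod_0; apply Rle_refl.
  - rewrite Csum_cons, Rsum_cons.
    eapply Rle_trans; [apply Cmod_triangle|lra].
Qed.

(** Compares the sums over nested lists without deciding equality of indices. *)
Lemma sublist_complement {I} (L0 L : list I) :
  NoDup L0 -> incl L0 L -> exists R, Permutation L (L0 ++ R).
Proof.
  revert L; induction L0 as [|x L0 IH]; intros L Hnd Hin.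
  - exists L; apply Permutation_refl.
  - inversion Hnd; subst.
    destruct (in_split x L) as [l1 [l2 ->]]; [apply Hin; now left|].
    destruct (IH (l1 ++ l2)) as [R HR]; auto.
    + intros y Hy.
      assert (Hy' : In y (l1 ++ x :: l2)) by (apply Hin; now right).
      rewrite in_app_iff in *; simpl in Hy'.
      destruct Hy' as [?|[<-|?]]; tauto.
    + exists R; simpl.
      eapply Permutation_trans; [symmetry; apply Permutation_middle|].
      now constructor.
Qed.

Lemma Rsum_incl {I} (u : I -> R) L M :
  (forall i, 0 <= u i)%R -> NoDup L -> incl L M ->
  (Rsum_list u L <= Rsum_list u M)%R.
Proof.
  intros Hu HL Hi; destruct (sublist_complement L M HL Hi) as [R HR].
  rewrite (Rsum_perm _ _ _ HR), Rsum_app.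
  pose proof (Rsum_nonneg u R Hu); lra.
Qed.

(** Filters by an undecidable predicate and removes repetitions at once. *)
Lemma list_restrict {I} (p : I -> Prop) (L : list I) :
  exists L', NoDup L' /\ forall x, In x L' <-> In x L /\ p x.
Proof.
  induction L as [|y L [L' [Hnd HL']]].
  - exists []; split; [constructor|simpl; tauto].
  - destruct (classic (p y /\ ~ In y L')) as [[H1 H2]|H].
    + exists (y :: L'); split; [now constructor|].
      intros x; simpl; rewrite HL'; split.
      * intros [<-|?]; tauto.
      * tauto.
    + exists L'; split; auto.
      intros x; simpl; rewrite HL'; split; [tauto|].
      intros [[<-|?] ?]; [|tauto].
      apply NNPP; intros Hn; apply H; split; auto.
      rewrite HL'; tauto.
Qed.

(** * Unordered sums *)

Lemma ball_C_of_Cmod (x y : C) (e : R) : (Cmod (y - x) < e)%R -> ball x e y.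
Proof. apply C_NormedModule_mixin_compat1. Qed.

Lemma Cmod_of_ball_C (x y : C) (e : posreal) :
  ball x e y -> (Cmod (y - x) < sqrt 2 * e)%R.
Proof. apply C_NormedModule_mixin_compat2. Qed.

Lemma sqrt2_pos : (0 < sqrt 2)%R.
Proof. apply sqrt_lt_R0; lra. Qed.

(** A lower bound [L0] lying in [P] can be made duplicate-free, so that every set
    of the filter is inhabited. *)
#[local] Instance finite_subsets_proper {I} (P : I -> Prop) :
  ProperFilter (finite_subsets P).
Proof.
  constructor.
  - intros Q [L0 [H0 H]].
    destruct (list_restrict P L0) as [L [Hnd HL]].
    exists L; apply H; auto.
    + apply List.Forall_forall; intros x Hx; now apply HL.
    + intros x Hx; apply HL; split; auto.
      now apply (proj1 (List.Forall_forall P L0) H0).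
  - constructor.
    + exists []; split; auto.
    + intros Q1 Q2 [L1 [H1 HQ1]] [L2 [H2 HQ2]].
      exists (L1 ++ L2); split; [now apply List.Forall_app|].
      intros L Hnd HP Hi; split; [apply HQ1|apply HQ2]; auto;
        intros x Hx; apply Hi, in_or_app; tauto.
    + intros Q1 Q2 H12 [L1 [H1 HQ1]]; exists L1; split; auto.
Qed.

(** The topology of [C] in [is_sum_over] is that of a product of two copies of
    [R]; this is the same convergence in terms of the modulus. *)
Lemma is_sum_over_eps {I} (P : I -> Prop) (f : I -> C) l :
  is_sum_over P f l <->
  forall eps : R, (0 < eps)%R ->
    exists L0, List.Forall P L0 /\
        forall L, NoDup L -> List.Forall P L -> incl L0 L ->
      (Cmod (Csum_list f L - l) < eps)%R.
Proof.
  unfold is_sum_over; rewrite filterlim_locally; split.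
  - intros H eps He.
    assert (He' : (0 < eps / sqrt 2)%R)
      by (apply Rdiv_lt_0_compat; auto using sqrt2_pos).
    destruct (H (mkposreal _ He')) as [L0 [H0 HL]].
    exists L0; split; auto; intros L H1 H2 H3.
    specialize (HL L H1 H2 H3); apply Cmod_of_ball_C in HL; simpl in HL.
    replace eps with (sqrt 2 * (eps / sqrt 2))%R; auto.
    field; apply Rgt_not_eq, sqrt2_pos.
  - intros H eps.
    destruct (H eps (cond_pos eps)) as [L0 [H0 HL]].
    exists L0; split; auto; intros L H1 H2 H3.
    apply ball_C_of_Cmod; auto.
Qed.

Lemma is_sum_over_unique {I} (P : I -> Prop) (f : I -> C) l l' :
  is_sum_over P f l -> is_sum_over P f l' -> l = l'.
Proof.
  intros H H'.
  apply (filterlim_locally_unique (V := C_NormedModule) _ _ _ H H').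
Qed.

Lemma is_sum_over_ext {I} (P : I -> Prop) (f g : I -> C) l :
  (forall i, P i -> f i = g i) -> is_sum_over P f l -> is_sum_over P g l.
Proof.
  intros Hfg; rewrite !is_sum_over_eps; intros H eps He.
  destruct (H eps He) as [L0 [H0 HL]]; exists L0; split; auto.
  intros L H1 H2 H3; rewrite (Csum_ext g f); auto.
  intros i Hi; symmetry; apply Hfg.
  now apply (proj1 (List.Forall_forall P L) H2).
Qed.

Lemma is_sum_over_finite {I} (P : I -> Prop) (f : I -> C) L :
  NoDup L -> (forall i, In i L <-> P i) -> is_sum_over P f (Csum_list f L).
Proof.
  intros Hnd HL; apply is_sum_over_eps; intros eps He.
  exists L; split; [apply List.Forall_forall; intros; now apply HL|].
  intros M H1 H2 H3; rewrite (Csum_perm f M L).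
  - replace (_ - _) with (RtoC 0) by ring; now rewrite Cmod_0.
  - apply NoDup_Permutation; auto.
    intros x; split; [|apply H3].
    intros Hx; apply HL; now apply (proj1 (List.Forall_forall P M) H2).
Qed.

Lemma is_sum_over_scal {I} (P : I -> Prop) (f : I -> C) c l :
  is_sum_over P f l -> is_sum_over P (fun i => c * f i) (c * l).
Proof.
  rewrite !is_sum_over_eps; intros H eps He.
  assert (Hc : (0 < Cmod c + 1)%R) by (pose proof (Cmod_ge_0 c); lra).
  destruct (H (eps / (Cmod c + 1))%R) as [L0 [H0 HL]].
  { now apply Rdiv_lt_0_compat. }
  exists L0; split; auto; intros L H1 H2 H3.
  specialize (HL L H1 H2 H3).
  rewrite Csum_scal; replace (_ - _) with (c * (Csum_list f L - l)) by ring.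
  rewrite Cmod_mult.
  assert (Cmod (Csum_list f L - l) * (Cmod c + 1) < eps)%R.
  { apply Rmult_lt_compat_r with (r := (Cmod c + 1)%R) in HL; auto.
    replace (eps / (Cmod c + 1) * (Cmod c + 1))%R with eps in HL; auto.
    field; lra. }
  pose proof (Cmod_ge_0 (Csum_list f L - l)); lra.
Qed.

Lemma is_sum_over_plus {I} (P : I -> Prop) (f g : I -> C) l m :
  is_sum_over P f l -> is_sum_over P g m ->
  is_sum_over P (fun i => f i + g i) (l + m).
Proof.
  rewrite !is_sum_over_eps; intros Hf Hg eps He.
  destruct (Hf (eps / 2)%R) as [L1 [H1 HL1]]; [lra|].
  destruct (Hg (eps / 2)%R) as [L2 [H2 HL2]]; [lra|].
  exists (L1 ++ L2); split; [now apply List.Forall_app|].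
  intros L Hnd HP Hi.
  specialize (HL1 L Hnd HP (fun x Hx => Hi x (in_or_app _ _ _ (or_introl Hx)))).
  specialize (HL2 L Hnd HP (fun x Hx => Hi x (in_or_app _ _ _ (or_intror Hx)))).
  rewrite Csum_plus.
  replace (_ - _) with ((Csum_list f L - l) + (Csum_list g L - m)) by ring.
  eapply Rle_lt_trans; [apply Cmod_triangle|lra].
Qed.

(** Approximate the sum over each of finitely many fibers by a finite sum that
    already contains the part of [L0] in this fiber; together these finite sums
    lie above [L0].  Reindexing, iterated sums and summation along antidiagonals
    are special choices of [pi]. *)
Theorem is_sum_over_fibers {I A} (P : I -> Prop) (Q : A -> Prop) (pi : I -> A)
    (f : I -> C) (g : A -> C) l :
  (forall i, P i -> Q (pi i)) ->
  is_sum_over P f l ->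
  (forall a, Q a -> is_sum_over (fun i => P i /\ pi i = a) f (g a)) ->
  is_sum_over Q g l.
Proof.
  intros Hpi Hf Hg; apply is_sum_over_eps; intros eps He.
  destruct (proj1 (is_sum_over_eps _ _ _) Hf (eps / 2)%R) as [L0 [H0 HL0]];
    [lra|].
  assert (Key : forall delta : R, (0 < delta)%R -> forall M, NoDup M ->
    List.Forall Q M -> exists L, NoDup L /\
      (forall i, In i L -> P i /\ In (pi i) M) /\
      (forall i, In i L0 -> In (pi i) M -> In i L) /\
      (Cmod (Csum_list f L - Csum_list g M) <= INR (length M) * delta)%R).
  { intros delta Hd; induction M as [|a M IH]; intros Hnd HQ.
    - exists []; split; [constructor|]; split; [now intros ? []|].
      split; [now intros ? _ []|].
      unfold Csum_list; simpl; replace (0 - 0) with (RtoC 0) by ring.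
      rewrite Cmod_0; lra.
    - inversion Hnd; inversion HQ; subst.
      destruct IH as [L [N1 [N2 [N3 N4]]]]; auto.
      destruct (proj1 (is_sum_over_eps _ _ _) (Hg a ltac:(auto)) delta Hd)
        as [La [HLa1 HLa2]].
      destruct (list_restrict (fun i => P i /\ pi i = a) (La ++ L0))
        as [L' [K1 K2]].
      exists (L' ++ L); repeat split.
      + apply NoDup_app; auto.
        intros x Hx Hx'; apply K2 in Hx; apply N2 in Hx'.
        destruct Hx as [_ [_ <-]]; tauto.
      + apply in_app_or in H; destruct H as [H|H];
          [now apply K2 in H|now apply N2 in H].
      + apply in_app_or in H; destruct H as [H|H].
        * apply K2 in H; left; symmetry; tauto.
        * right; now apply N2 in H.
      + intros i Hi [Ha|Hi'].
        * apply in_or_app; left; apply K2; split; [apply in_or_app; tauto|].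
          split; auto; now apply (proj1 (List.Forall_forall P L0) H0).
        * apply in_or_app; right; auto.
      + rewrite Csum_app, Csum_cons.
        replace (_ - _) with ((Csum_list f L' - g a)
          + (Csum_list f L - Csum_list g M)) by ring.
        assert (Cmod (Csum_list f L' - g a) < delta)%R.
        { apply HLa2; auto.
          - apply List.Forall_forall; intros x Hx; now apply K2 in Hx.
          - intros x Hx; apply K2; split; [apply in_or_app; tauto|].
            now apply (proj1 (List.Forall_forall _ La) HLa1) in Hx. }
        eapply Rle_trans; [apply Cmod_triangle|].
        change (length (a :: M)) with (S (length M)); rewrite S_INR; lra. }
  (* The error of each fiber is divided by the number of fibers, which is known
     only now; the summand 1 covers the empty list. *)
  exists (map pi L0); split.
  { apply List.Forall_forall; intros a Ha; apply in_map_iff in Ha.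
    destruct Ha as [i [<- Hi]]; apply Hpi.
    now apply (proj1 (List.Forall_forall P L0) H0). }
  intros M Hnd HQ Hi.
  assert (HM : (0 < INR (length M) + 1)%R)
    by (pose proof (pos_INR (length M)); lra).
  destruct (Key (eps / 2 / (INR (length M) + 1))%R) with (M := M)
    as [L [N1 [N2 [N3 N4]]]]; auto.
  { apply Rdiv_lt_0_compat; lra. }
  assert (HL : (Cmod (Csum_list f L - l) < eps / 2)%R).
  { apply HL0; auto.
    - apply List.Forall_forall; intros i Hx; now apply N2.
    - intros i Hx; apply N3; auto; apply Hi, in_map; auto. }
  replace (_ - _) with ((Csum_list f L - l)
    + - (Csum_list f L - Csum_list g M)) by ring.
  eapply Rle_lt_trans; [apply Cmod_triangle|]; rewrite Cmod_opp.
  assert (INR (length M) * (eps / 2 / (INR (length M) + 1)) <= eps / 2)%R.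
  { apply Rmult_le_reg_r with (INR (length M) + 1)%R; auto.
    replace (_ * _ * _)%R with (INR (length M) * (eps / 2))%R by (field; lra).
    nra. }
  lra.
Qed.

(** * Absolutely summable families *)

Definition every {I : Type} : I -> Prop := fun _ => True.

Lemma Forall_all {I} (L : list I) : List.Forall every L.
Proof. apply List.Forall_forall; intros; exact Logic.I. Qed.

Definition sums_bounded {I} (u : I -> R) : Prop :=
  exists M, forall L, NoDup L -> (Rsum_list u L <= M)%R.

Definition abs_summable {I} (f : I -> C) : Prop :=
  sums_bounded (fun i => Cmod (f i)).

Lemma sums_bounded_prod {I J} (u : I -> R) (v : J -> R) :
  (forall i, 0 <= u i)%R -> (forall j, 0 <= v j)%R ->
  sums_bounded u -> sums_bounded v ->
  sums_bounded (fun p => u (fst p) * v (snd p))%R.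
Proof.
  intros Hu Hv [Mu Bu] [Mv Bv]; exists (Mu * Mv)%R; intros L HL.
  destruct (list_restrict every (map fst L)) as [L1 [N1 K1]].
  destruct (list_restrict every (map snd L)) as [L2 [N2 K2]].
  eapply Rle_trans.
  - apply (Rsum_incl _ L (list_prod L1 L2)); auto.
    + intros [i j]; simpl; now apply Rmult_le_pos.
    + intros [i j] Hx; apply in_prod; [apply K1|apply K2]; split;
        try exact Logic.I; apply in_map_iff; now exists (i, j).
  - rewrite Rsum_prod; apply Rmult_le_compat; auto using Rsum_nonneg.
Qed.

Lemma abs_summable_dominated {I} (f : I -> C) (u : I -> R) K :
  sums_bounded u -> (0 <= K)%R -> (forall i, Cmod (f i) <= K * u i)%R ->
  abs_summable f.
Proof.
  intros [M HM] HK Hf; exists (K * M)%R; intros L HL.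
  eapply Rle_trans; [apply Rsum_le, Hf|].
  rewrite Rsum_scal; apply Rmult_le_compat_l; auto.
Qed.

(** Unconditional form of the Cauchy criterion: beyond a finite set that almost
    attains the supremum of the sums of moduli, little is left to add. *)
Lemma abs_summable_ex {I} (f : I -> C) :
  abs_summable f -> exists l, is_sum_over every f l.
Proof.
  intros [M HM].
  set (E := fun x => exists L, NoDup L /\ x = Rsum_list (fun i => Cmod (f i)) L).
  destruct (completeness E) as [m [Hub Hlub]].
  - exists M; intros x [L [HL ->]]; auto.
  - exists 0%R; exists []; split; [constructor|reflexivity].
  - apply (filterlim_locally_cauchy (U := C_CompleteNormedModule)
             (F := finite_subsets every)).
    intros eps.
    assert (HL0 : exists L0, NoDup L0 /\
      (m - eps / 2 < Rsum_list (fun i => Cmod (f i)) L0)%R).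
    { apply NNPP; intros Hn.
      assert (m <= m - eps / 2)%R; [|pose proof (cond_pos eps); lra].
      apply Hlub; intros x [L [HL ->]].
      apply Rnot_lt_le; intros Hlt; apply Hn; exists L; auto. }
    destruct HL0 as [L0 [Hnd HL0]].
    exists (fun L => NoDup L /\ incl L0 L); split.
    { exists L0; split; auto using Forall_all. }
    assert (Near : forall L, NoDup L -> incl L0 L ->
      (Cmod (Csum_list f L - Csum_list f L0) < eps / 2)%R).
    { intros L H1 H2; destruct (sublist_complement L0 L Hnd H2) as [R HR].
      rewrite (Csum_perm f _ _ HR), Csum_app.
      replace (_ - _) with (Csum_list f R) by ring.
      eapply Rle_lt_trans; [apply Cmod_Csum|].
      assert (Rsum_list (fun i => Cmod (f i)) L <= m)%R
        by (apply Hub; exists L; auto).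
      rewrite (Rsum_perm _ _ _ HR), Rsum_app in H; lra. }
    intros U V [HU1 HU2] [HV1 HV2]; apply ball_C_of_Cmod.
    replace (_ - _) with ((Csum_list f V - Csum_list f L0)
      + - (Csum_list f U - Csum_list f L0)) by ring.
    eapply Rle_lt_trans; [apply Cmod_triangle|]; rewrite Cmod_opp.
    pose proof (Near U HU1 HU2); pose proof (Near V HV1 HV2); lra.
Qed.

(** The sum as a function of the family, with an arbitrary value when the family
    is not summable. *)
Definition tsum {I} (f : I -> C) : C :=
  epsilon (inhabits (RtoC 0)) (fun l => is_sum_over every f l).

Lemma tsum_correct {I} (f : I -> C) :
  abs_summable f -> is_sum_over every f (tsum f).
Proof. intros H; unfold tsum; apply epsilon_spec, abs_summable_ex, H. Qed.

(** The image of [h] may miss indices of [P] at which the family vanishes: the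
    fibers there are empty. *)
Lemma is_sum_over_reindex {I J} (h : J -> I) (P : I -> Prop) (f : I -> C) l :
  (forall x y, h x = h y -> x = y) -> (forall j, P (h j)) ->
  (forall i, P i -> (exists j, h j = i) \/ f i = 0) ->
  is_sum_over every (fun j => f (h j)) l -> is_sum_over P f l.
Proof.
  intros Hinj HP Hzero H.
  apply (is_sum_over_fibers every P h (fun j => f (h j))); auto.
  intros i Hi; destruct (classic (exists j, h j = i)) as [[j <-]|Hn].
  - replace (f (h j)) with (Csum_list (fun j => f (h j)) [j])
      by (unfold Csum_list; simpl; ring).
    apply is_sum_over_finite; [repeat constructor; intros []|].
    intros x; simpl; split; [intros [->|[]]; split; auto; exact Logic.I|].
    intros [_ Hx]; left; symmetry; auto.
  - destruct (Hzero i Hi) as [?| ->]; [tauto|].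
    change (RtoC 0) with (Csum_list (fun j => f (h j)) []).
    apply is_sum_over_finite; [constructor|].
    intros x; simpl; split; [intros []|intros [_ Hx]; apply Hn; eauto].
Qed.

Lemma is_sum_over_fst {I J} (f : I * J -> C) (g : I -> C) l :
  is_sum_over every f l ->
  (forall i, is_sum_over every (fun j => f (i, j)) (g i)) ->
  is_sum_over every g l.
Proof.
  intros Hf Hg; apply (is_sum_over_fibers every every fst f g); auto.
  intros i _; apply (is_sum_over_reindex (fun j => (i, j))); auto.
  - intros x y E; congruence.
  - intros j; split; [exact Logic.I|reflexivity].
  - intros [i' j] [_ <-]; left; now exists j.
Qed.

Lemma is_sum_over_snd {I J} (f : I * J -> C) (g : J -> C) l :
  is_sum_over every f l ->
  (forall j, is_sum_over every (fun i => f (i, j)) (g j)) ->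
  is_sum_over every g l.
Proof.
  intros Hf Hg; apply (is_sum_over_fibers every every snd f g); auto.
  intros j _; apply (is_sum_over_reindex (fun i => (i, j))); auto.
  - intros x y E; congruence.
  - intros i; split; [exact Logic.I|reflexivity].
  - intros [i j'] [_ <-]; left; now exists i.
Qed.

(** * Families indexed by natural numbers *)

Definition bsum (f : nat -> C) (n : nat) : C := Csum_list f (seq 0 n).

Lemma bsum_0 (f : nat -> C) : bsum f 0 = 0.
Proof. reflexivity. Qed.

Lemma bsum_S (f : nat -> C) n : bsum f (S n) = bsum f n + f n.
Proof.
  unfold bsum; rewrite seq_S, Csum_app; simpl.
  unfold Csum_list at 2; simpl; ring.
Qed.

Lemma bsum_ext (f g : nat -> C) n :
  (forall k, (k < n)%nat -> f k = g k) -> bsum f n = bsum g n.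
Proof. intros H; apply Csum_ext; intros k Hk; apply in_seq in Hk; apply H; lia. Qed.

Lemma bsum_plus (f g : nat -> C) n : bsum (fun k => f k + g k) n
  = bsum f n + bsum g n.
Proof. apply Csum_plus. Qed.

Lemma bsum_scal c (f : nat -> C) n : bsum (fun k => c * f k) n = c * bsum f n.
Proof. apply Csum_scal. Qed.

Lemma bsum_zero (f : nat -> C) n : (forall k, (k < n)%nat -> f k = 0) -> bsum f n
  = 0.
Proof.
  intros H; rewrite (bsum_ext f (fun k => 0 * f k)).
  - rewrite bsum_scal; ring.
  - intros k Hk; rewrite (H k Hk); ring.
Qed.

Lemma bsum_split (f : nat -> C) m n :
  bsum f (m + n) = bsum f m + bsum (fun k => f (m + k)%nat) n.
Proof.
  induction n as [|n IH]; [rewrite Nat.add_0_r, bsum_0; ring|].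
  rewrite Nat.add_succ_r, !bsum_S, IH; ring.
Qed.

Lemma bsum_first (f : nat -> C) n : bsum f (S n)
  = f 0%nat + bsum (fun k => f (S k)) n.
Proof.
  change (S n) with (1 + n)%nat.
  rewrite (bsum_split f 1 n), bsum_S, bsum_0; simpl; ring.
Qed.

Lemma bsum_rev (f : nat -> C) n : bsum (fun k => f (n - 1 - k)%nat) n = bsum f n.
Proof.
  induction n as [|n IH]; auto.
  rewrite bsum_first, bsum_S, Cplus_comm; f_equal; [|f_equal; lia].
  rewrite <- IH; apply bsum_ext; intros k Hk; f_equal; lia.
Qed.

Lemma is_sum_over_antidiagonal (f : nat * nat -> C) l :
  is_sum_over every f l ->
  is_sum_over every (fun n => bsum (fun r => f (r, n - r)%nat) (S n)) l.
Proof.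
  intros Hf.
  apply (is_sum_over_fibers every every (fun p => fst p + snd p)%nat f); auto.
  intros n _; unfold bsum.
  rewrite <- (Csum_map (fun r => (r, n - r)%nat) f).
  apply is_sum_over_finite.
  - apply FinFun.Injective_map_NoDup; [|apply seq_NoDup].
    intros x y E; congruence.
  - intros [r s]; rewrite in_map_iff; cbn [fst snd]; split.
    + intros [x [E Hx]]; apply in_seq in Hx; injection E; intros; subst.
      split; [exact Logic.I|lia].
    + intros [_ <-]; exists r; split; [f_equal; lia|apply in_seq; lia].
Qed.

Lemma is_sum_over_nat_shift (f : nat -> C) l :
  f 0%nat = 0 -> is_sum_over every (fun n => f (S n)) l -> is_sum_over every f l.
Proof.
  intros H0; apply (is_sum_over_reindex S).
  - intros; lia.
  - intros; exact Logic.I.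
  - intros [|i] _; [now right|left; now exists i].
Qed.

Lemma is_sum_over_nat_first (f : nat -> C) l m :
  is_sum_over every f l -> is_sum_over every (fun n => f (S n)) m -> l
      = f 0%nat + m.
Proof.
  intros Hl Hm.
  set (f0 := fun n => match n with O => f 0%nat | S _ => RtoC 0 end).
  set (f1 := fun n => match n with O => RtoC 0 | S k => f (S k) end).
  assert (H0 : is_sum_over every f0 (f 0%nat)).
  { apply (is_sum_over_reindex (fun _ : unit => 0%nat)).
    - now intros [] [].
    - intros; exact Logic.I.
    - intros [|n] _; [left; now exists tt|now right].
    - replace (f 0%nat) with (Csum_list (fun _ : unit => f0 0%nat) [tt])
        by (unfold Csum_list; simpl; ring).
      apply is_sum_over_finite; [repeat constructor; intros []|].
      intros []; simpl; split; auto; intros; exact Logic.I. }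
  assert (H1 : is_sum_over every f1 m) by now apply is_sum_over_nat_shift.
  apply (is_sum_over_unique every f); auto.
  apply (is_sum_over_ext every (fun n => f0 n + f1 n)).
  - intros [|n] _; simpl; ring.
  - now apply is_sum_over_plus.
Qed.

Definition tends (u : nat -> C) (l : C) : Prop :=
  forall eps : R, (0 < eps)%R -> exists N, forall n, (N <= n)%nat ->
    (Cmod (u n - l) < eps)%R.

Lemma tends_filterlim u l : tends u l <-> filterlim u eventually (locally l).
Proof.
  rewrite filterlim_locally; split.
  - intros H eps; destruct (H eps (cond_pos eps)) as [N HN].
    exists N; intros n Hn; apply ball_C_of_Cmod; auto.
  - intros H eps He.
    assert (He' : (0 < eps / sqrt 2)%R)
      by (apply Rdiv_lt_0_compat; auto using sqrt2_pos).
    destruct (H (mkposreal _ He')) as [N HN]; exists N; intros n Hn.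
    specialize (HN n Hn); apply Cmod_of_ball_C in HN; simpl in HN.
    replace eps with (sqrt 2 * (eps / sqrt 2))%R; auto.
    field; apply Rgt_not_eq, sqrt2_pos.
Qed.

Lemma tends_unique u l m : tends u l -> tends u m -> l = m.
Proof.
  rewrite !tends_filterlim; intros H H'.
  apply (filterlim_locally_unique (V := C_NormedModule) _ _ _ H H').
Qed.

Lemma tends_ext (u v : nat -> C) l : (forall n, u n
  = v n) -> tends u l -> tends v l.
Proof.
  intros E H eps He; destruct (H eps He) as [N HN]; exists N; intros n Hn.
  rewrite <- E; auto.
Qed.

Lemma tends_const l : tends (fun _ => l) l.
Proof.
  intros eps He; exists 0%nat; intros n _.
  replace (l - l) with (RtoC 0) by ring; now rewrite Cmod_0.
Qed.

Lemma tends_subseq u l (h : nat -> nat) :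
  (forall n, (n <= h n)%nat) -> tends u l -> tends (fun n => u (h n)) l.
Proof.
  intros Hh H eps He; destruct (H eps He) as [N HN]; exists N; intros n Hn.
  apply HN; specialize (Hh n); lia.
Qed.

Lemma tends_bounded u l :
  tends u l -> exists N B, (0 < B)%R /\
    forall n, (N <= n)%nat -> (Cmod (u n) <= B)%R.
Proof.
  intros H; destruct (H 1%R Rlt_0_1) as [N HN].
  exists N, (Cmod l + 1)%R; pose proof (Cmod_ge_0 l).
  split; [lra|]; intros n Hn; specialize (HN n Hn).
  replace (u n) with ((u n - l) + l) by ring.
  eapply Rle_trans; [apply Cmod_triangle|lra].
Qed.

Lemma tends_mult u v l m :
  tends u l -> tends v m -> tends (fun n => u n * v n) (l * m).
Proof.
  intros Hu Hv eps He.
  destruct (tends_bounded v m Hv) as [N0 [B [HB HN0]]].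
  pose proof (Cmod_ge_0 l) as Hl.
  destruct (Hu (eps / 2 / B)%R) as [N1 HN1].
  { apply Rdiv_lt_0_compat; lra. }
  destruct (Hv (eps / 2 / (Cmod l + 1))%R) as [N2 HN2].
  { apply Rdiv_lt_0_compat; lra. }
  exists (N0 + N1 + N2)%nat; intros n Hn.
  specialize (HN0 n ltac:(lia)); specialize (HN1 n ltac:(lia)).
  specialize (HN2 n ltac:(lia)).
  replace (_ - _) with ((u n - l) * v n + l * (v n - m)) by ring.
  eapply Rle_lt_trans; [apply Cmod_triangle|]; rewrite !Cmod_mult.
  pose proof (Cmod_ge_0 (u n - l)); pose proof (Cmod_ge_0 (v n)).
  pose proof (Cmod_ge_0 (v n - m)).
  assert (Cmod (u n - l) * Cmod (v n) <= Cmod (u n - l) * B)%R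
    by (apply Rmult_le_compat_l; auto).
  assert (Cmod (u n - l) * B < eps / 2)%R.
  { apply Rmult_lt_compat_r with (r := B) in HN1; auto.
    replace (eps / 2 / B * B)%R with (eps / 2)%R in HN1; auto; field; lra. }
  assert (Cmod (v n - m) * (Cmod l + 1) < eps / 2)%R.
  { apply Rmult_lt_compat_r with (r := (Cmod l + 1)%R) in HN2; [|lra].
    replace (eps / 2 / (Cmod l + 1) * (Cmod l + 1))%R with (eps / 2)%R in HN2;
      auto; field; lra. }
  nra.
Qed.

(** The initial segments of [nat] are cofinal among its finite subsets. *)
Lemma bsum_tends (f : nat -> C) l : is_sum_over every f l -> tends (bsum f) l.
Proof.
  rewrite is_sum_over_eps; intros H eps He.
  destruct (H eps He) as [L0 [_ HL]].
  exists (S (list_max L0)); intros n Hn; apply HL.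
  - apply seq_NoDup.
  - apply Forall_all.
  - intros k Hk; apply in_seq.
    assert (k <= list_max L0)%nat; [|lia].
    pose proof (proj1 (list_max_le L0 (list_max L0)) (Nat.le_refl _)) as Hm.
    now apply (proj1 (List.Forall_forall _ _) Hm).
Qed.

Lemma is_series_of_sum (f : nat -> C) l :
  is_sum_over every f l -> is_series (K := C_AbsRing) (V := C_NormedModule) f l.
Proof.
  intros H; apply bsum_tends in H.
  apply (tends_subseq _ _ S) in H; [|lia].
  apply (tends_filterlim (sum_n f)).
  eapply tends_ext; [|exact H].
  intros n; simpl; induction n as [|n IH].
  - rewrite sum_O, bsum_S, bsum_0; ring.
  - rewrite sum_Sn, bsum_S, IH; reflexivity.
Qed.

Lemma is_sum_over_of_partial (f : nat -> C) l :
  abs_summable f -> tends (bsum f) l -> is_sum_over every f l.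
Proof.
  intros Hf Hl; destruct (abs_summable_ex f Hf) as [m Hm].
  replace l with m; auto.
  eapply tends_unique; [apply bsum_tends, Hm|exact Hl].
Qed.

Lemma geometric_sums_bounded (rho : R) :
  (0 <= rho < 1)%R -> sums_bounded (fun n : nat => rho ^ n)%R.
Proof.
  intros Hr; exists (/ (1 - rho))%R; intros L HL.
  assert (Hseq : forall n, (Rsum_list (fun n => rho ^ n) (seq 0 n)
    = (1 - rho ^ n) / (1 - rho))%R).
  { induction n as [|n IH]; [unfold Rsum_list; simpl; field; lra|].
    rewrite seq_S, Rsum_app, IH; unfold Rsum_list; simpl; field; lra. }
  eapply Rle_trans.
  - apply (Rsum_incl _ L (seq 0 (S (list_max L)))); auto.
    + intros n; apply pow_le; lra.
    + intros k Hk; apply in_seq.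
      pose proof (proj1 (list_max_le L (list_max L)) (Nat.le_refl _)) as Hm.
      assert (k <= list_max L)%nat; [|lia].
      now apply (proj1 (List.Forall_forall _ _) Hm).
  - rewrite Hseq; unfold Rdiv.
    assert (0 < / (1 - rho))%R by (apply Rinv_0_lt_compat; lra).
    pose proof (pow_le rho (S (list_max L)) ltac:(lra)); nra.
Qed.

Lemma pow_antitone (rho : R) m n :
  (0 <= rho <= 1)%R -> (m <= n)%nat -> (rho ^ n <= rho ^ m)%R.
Proof.
  intros Hr H; replace n with (m + (n - m))%nat by lia; rewrite pow_add.
  assert (0 <= rho ^ m)%R by (apply pow_le; lra).
  assert (rho ^ (n - m) <= 1)%R.
  { rewrite <- (pow1 (n - m)); apply pow_incr; lra. }
  assert (0 <= rho ^ (n - m))%R by (apply pow_le; lra).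
  nra.
Qed.

Lemma tends_of_increments (rho K : R) (u : nat -> C) :
  (0 <= rho < 1)%R -> (0 <= K)%R ->
  (forall n, Cmod (u (S n) - u n) <= K * rho ^ n)%R ->
  exists l, tends u l.
Proof.
  intros Hr HK Hu.
  destruct (abs_summable_ex (fun n => u (S n) - u n)) as [l Hl].
  { now apply (abs_summable_dominated _ (fun n => rho ^ n)%R K);
      [apply geometric_sums_bounded| |]. }
  apply bsum_tends in Hl; exists (l + u 0%nat).
  intros eps He; destruct (Hl eps He) as [N HN]; exists N; intros n Hn.
  specialize (HN n Hn).
  replace (u n - _) with (bsum (fun n => u (S n) - u n) n - l); auto.
  assert (E : bsum (fun n => u (S n) - u n) n = u n - u 0%nat).
  { clear; induction n as [|n IH]; [rewrite bsum_0; ring|].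
    rewrite bsum_S, IH; ring. }
  rewrite E; ring.
Qed.

Lemma Cmod_sum_le {I} (f : I -> C) l M :
  is_sum_over every f l ->
  (forall L, NoDup L -> Rsum_list (fun i => Cmod (f i)) L <= M)%R ->
  (Cmod l <= M)%R.
Proof.
  rewrite is_sum_over_eps; intros Hl HM; apply le_epsilon; intros eps He.
  destruct (Hl eps He) as [L0 [_ HL]].
  destruct (list_restrict every L0) as [L [Hnd Hin]].
  specialize (HL L Hnd (Forall_all L)).
  assert (Hi : incl L0 L) by (intros x Hx; apply Hin; split; auto; exact Logic.I).
  specialize (HL Hi).
  replace l with (Csum_list f L + - (Csum_list f L - l)) by ring.
  eapply Rle_trans; [apply Cmod_triangle|]; rewrite Cmod_opp.
  pose proof (Cmod_Csum f L); pose proof (HM L Hnd); lra.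
Qed.

(** * The products (q)_n *)

Fixpoint tri (n : nat) : nat :=
  match n with O => O | S k => (k + tri k)%nat end.

Lemma tri_double n : (2 * tri n + n = n * n)%nat.
Proof. induction n as [|n IH]; simpl; [reflexivity|nia]. Qed.

Section QSeries.

Context (q : C) (hq : (Cmod q < 1)%R).

Let rho := Cmod q.

Lemma rho_range : (0 <= rho < 1)%R.
Proof. split; [apply Cmod_ge_0|exact hq]. Qed.

Lemma rho_pow_range n : (0 <= rho ^ n <= 1)%R.
Proof.
  pose proof rho_range; split; [apply pow_le; lra|].
  rewrite <- (pow1 n); apply pow_incr; lra.
Qed.

Definition qfact (n : nat) : C := qpoch q q n.

Definition inv_qfact (n : nat) : C := / qfact n.

Lemma qfact_S n : qfact (S n) = qfact n * (1 - q ^ S n).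
Proof.
  change (qfact (S n)) with (qfact n * (1 - q ^ n * q)).
  rewrite Cpow_S; ring.
Qed.

Lemma Cmod_one_minus_pow n : (1 - rho ^ S n <= Cmod (1 - q ^ S n))%R.
Proof.
  unfold rho; rewrite <- Cmod_pow.
  pose proof (Cmod_triangle (1 - q ^ S n) (q ^ S n)) as H.
  replace (1 - q ^ S n + q ^ S n) with (RtoC 1) in H by ring.
  rewrite Cmod_1 in H; lra.
Qed.

Lemma rho_pow_S_le n : (rho ^ S n <= rho * rho ^ n /\ rho ^ S n <= rho)%R.
Proof.
  pose proof rho_range; pose proof (rho_pow_range n).
  simpl; split; nra.
Qed.

Lemma one_minus_pow_neq_0 n : 1 - q ^ S n <> 0.
Proof.
  intros E; pose proof (Cmod_one_minus_pow n) as H.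
  rewrite E, Cmod_0 in H; pose proof (rho_pow_S_le n); pose proof rho_range.
  lra.
Qed.

Lemma qfact_neq_0 n : qfact n <> 0.
Proof.
  induction n as [|n IH].
  - change (RtoC 1 <> 0); intros E; apply RtoC_inj in E; lra.
  - rewrite qfact_S; apply Cmult_neq_0; auto using one_minus_pow_neq_0.
Qed.

Lemma inv_qfact_0 : inv_qfact 0 = 1.
Proof. unfold inv_qfact; change (qfact 0)
  with (RtoC 1); field; intros E; apply RtoC_inj in E; lra. Qed.

Lemma inv_qfact_S n : inv_qfact n = (1 - q ^ S n) * inv_qfact (S n).
Proof.
  unfold inv_qfact; rewrite qfact_S; field; split;
    auto using qfact_neq_0, one_minus_pow_neq_0.
Qed.

Lemma qfact_inv_qfact n : qfact n * inv_qfact n = 1.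
Proof. unfold inv_qfact; field; apply qfact_neq_0. Qed.

Let geom n := ((1 - rho ^ n) / (1 - rho))%R.

Lemma geom_S n : geom (S n) = (geom n + rho ^ n)%R.
Proof. unfold geom; simpl; field; pose proof rho_range; lra. Qed.

Lemma geom_le n : (geom n <= / (1 - rho))%R.
Proof.
  unfold geom; pose proof rho_range; pose proof (rho_pow_range n).
  assert (0 < / (1 - rho))%R by (apply Rinv_0_lt_compat; lra).
  unfold Rdiv; nra.
Qed.

Lemma exp_monotone x y : (x <= y)%R -> (exp x <= exp y)%R.
Proof.
  intros [H| ->]; [left; now apply exp_increasing|apply Rle_refl].
Qed.

(** By [1 + x <= exp x] the product is at most the exponential of a geometric
    sum. *)
Lemma qfact_bounded : exists B, (0 <= B)%R /\ forall n, (Cmod (qfact n) <= B)%R.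
Proof.
  exists (exp (/ (1 - rho))); split; [left; apply exp_pos|]; intros n.
  apply Rle_trans with (exp (geom n)); [|apply exp_monotone, geom_le].
  induction n as [|n IH].
  - change (qfact 0) with (RtoC 1); rewrite Cmod_1.
    unfold geom; simpl; replace ((1 - 1) / (1 - rho))%R with 0%R
      by (field; pose proof rho_range; lra).
    rewrite exp_0; lra.
  - rewrite qfact_S, Cmod_mult, geom_S, exp_plus.
    apply Rmult_le_compat; auto using Cmod_ge_0.
    eapply Rle_trans; [apply Cmod_triangle|].
    rewrite Cmod_1, Cmod_opp, Cmod_pow; fold rho.
    eapply Rle_trans; [|apply exp_ineq1_le].
    pose proof (rho_pow_S_le n); pose proof rho_range;
      pose proof (rho_pow_range n); nra.
Qed.

(** [1 / (1 - x) <= 1 + x / (1 - rho)] for [0 <= x <= rho], which turns the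
    product of the inverses into the exponential of a geometric sum. *)
Lemma inv_qfact_bounded : exists B, (0 <= B)%R /\
  forall n, (Cmod (inv_qfact n) <= B)%R.
Proof.
  pose proof rho_range as Hr.
  assert (Hc : (0 < / (1 - rho))%R) by (apply Rinv_0_lt_compat; lra).
  exists (exp (/ (1 - rho) * / (1 - rho))); split; [left; apply exp_pos|].
  intros n.
  apply Rle_trans with (exp (/ (1 - rho) * geom n)).
  2: { apply exp_monotone, Rmult_le_compat_l; [lra|apply geom_le]. }
  induction n as [|n IH].
  - rewrite inv_qfact_0, Cmod_1.
    unfold geom; simpl; replace (/ (1 - rho) * ((1 - 1) / (1 - rho)))%R with 0%R
      by (field; lra).
    rewrite exp_0; lra.
  - rewrite geom_S, Rmult_plus_distr_l, exp_plus.
    pose proof (Cmod_one_minus_pow n) as H1.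
    pose proof (rho_pow_S_le n) as [H2 H3]; pose proof (rho_pow_range n) as H4.
    pose proof (rho_pow_range (S n)) as H5.
    assert (H6 : (1 <= Cmod (1 - q ^ S n) * exp (/ (1 - rho) * rho ^ n))%R).
    { apply Rle_trans with
        ((1 - rho ^ S n) * (1 + / (1 - rho) * rho ^ n))%R.
      - assert (/ (1 - rho) * rho ^ n * (1 - rho) = rho ^ n)%R by (field; lra).
        assert (0 <= / (1 - rho) * rho ^ n)%R by nra.
        nra.
      - apply Rmult_le_compat; auto; try lra.
        + assert (0 <= / (1 - rho) * rho ^ n)%R by nra; lra.
        + apply exp_ineq1_le. }
    rewrite (inv_qfact_S n), Cmod_mult in IH.
    pose proof (Cmod_ge_0 (inv_qfact (S n))).
    pose proof (exp_pos (/ (1 - rho) * rho ^ n)).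
    apply Rle_trans with (Cmod (inv_qfact (S n)) *
      (Cmod (1 - q ^ S n) * exp (/ (1 - rho) * rho ^ n)))%R; nra.
Qed.

Lemma tends_qfact : exists J, tends qfact J.
Proof.
  destruct qfact_bounded as [B [HB0 HB]].
  apply (tends_of_increments rho B); auto using rho_range.
  intros n; rewrite qfact_S.
  replace (_ - _) with (- (qfact n * q ^ S n)) by ring.
  rewrite Cmod_opp, Cmod_mult, Cmod_pow; fold rho.
  pose proof (rho_pow_S_le n); pose proof rho_range.
  apply Rmult_le_compat; auto using Cmod_ge_0.
  - apply pow_le; lra.
  - pose proof (rho_pow_range n); nra.
Qed.

Lemma tends_inv_qfact : exists W, tends inv_qfact W.
Proof.
  destruct inv_qfact_bounded as [B [HB0 HB]].
  apply (tends_of_increments rho B); auto using rho_range.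
  intros n; rewrite (inv_qfact_S n).
  replace (_ - _) with (inv_qfact (S n) * q ^ S n) by ring.
  rewrite Cmod_mult, Cmod_pow; fold rho.
  pose proof (rho_pow_S_le n); pose proof rho_range.
  apply Rmult_le_compat; auto using Cmod_ge_0.
  - apply pow_le; lra.
  - pose proof (rho_pow_range n); nra.
Qed.

(** From here on [J] is the infinite product and [W] its inverse. *)
Context (J W : C) (hJ : tends qfact J) (hW : tends inv_qfact W).

Lemma J_mult_W : J * W = 1.
Proof.
  eapply tends_unique; [apply (tends_mult _ _ _ _ hJ hW)|].
  eapply tends_ext; [|apply tends_const].
  intros n; symmetry; apply qfact_inv_qfact.
Qed.

(** * A partial theta function as a basic hypergeometric series *)

(** The factor that the index [r] contributes to a term when the argument is
    [q^i]. *)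
Definition monomial (i r : nat) : C := (- RtoC 1) ^ r * q ^ (tri r + i * r).

Lemma monomial_0 i : monomial i 0 = 1.
Proof. unfold monomial; rewrite Nat.mul_0_r; simpl; ring. Qed.

Lemma monomial_S i r : monomial i (S r) = - q ^ i * monomial (S i) r.
Proof.
  unfold monomial.
  replace (tri (S r) + i * S r)%nat with (i + (tri r + S i * r))%nat
    by (simpl; lia).
  rewrite (Cpow_add_r q i), (Cpow_S _ r); ring.
Qed.

(** The cross terms of the quadratic form act as shifts of the argument: this is
    what makes each partial sum over one index a function of the same kind. *)
Lemma monomial_shift i j r : monomial (i + j) r = q ^ (j * r) * monomial i r.
Proof.
  unfold monomial.
  replace (tri r + (i + j) * r)%nat with (j * r + (tri r + i * r))%nat by lia.
  rewrite Cpow_add_r; ring.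
Qed.

Lemma Cmod_monomial i r : (1 <= i)%nat -> (Cmod (monomial i r) <= rho ^ r)%R.
Proof.
  intros Hi; unfold monomial; rewrite Cmod_mult, !Cmod_pow, Cmod_m1, pow1.
  rewrite Rmult_1_l; apply pow_antitone; [pose proof rho_range; lra|nia].
Qed.

Definition theta (N : nat) : C := tsum (monomial N).

Lemma monomial_summable N : (1 <= N)%nat -> abs_summable (monomial N).
Proof.
  intros HN; apply (abs_summable_dominated _ (fun r => rho ^ r)%R 1).
  - apply geometric_sums_bounded, rho_range.
  - lra.
  - intros r; rewrite Rmult_1_l; now apply Cmod_monomial.
Qed.

Lemma is_theta N : (1 <= N)%nat -> is_sum_over every (monomial N) (theta N).
Proof. intros HN; now apply tsum_correct, monomial_summable. Qed.

Lemma theta_rec N : (1 <= N)%nat -> theta N = 1 - q ^ N * theta (S N).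
Proof.
  intros HN.
  rewrite (is_sum_over_nat_first (monomial N) (theta N) (- q ^ N * theta (S N))).
  - rewrite monomial_0; ring.
  - now apply is_theta.
  - eapply is_sum_over_ext; [intros r _; symmetry; apply monomial_S|].
    apply is_sum_over_scal, is_theta; lia.
Qed.

Definition inv_pair (N m : nat) : C := inv_qfact m * inv_qfact (m + N).

(** The basic hypergeometric series with upper parameters 0, lower parameter
    [q^(N+1)] and argument [q], divided by [(q)_N]. *)
Definition heine (N : nat) : C := tsum (fun m => q ^ m * inv_pair N m).

Lemma inv_pair_bounded : exists K, (0 <= K)%R /\
  forall N m, (Cmod (inv_pair N m) <= K)%R.
Proof.
  destruct inv_qfact_bounded as [B [HB0 HB]]; exists (B * B)%R; split; [nra|].
  intros N m; unfold inv_pair; rewrite Cmod_mult.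
  apply Rmult_le_compat; auto using Cmod_ge_0.
Qed.

Lemma heine_summable N : abs_summable (fun m => q ^ m * inv_pair N m).
Proof.
  destruct inv_pair_bounded as [K [HK0 HK]].
  apply (abs_summable_dominated _ (fun r => rho ^ r)%R K); auto.
  - apply geometric_sums_bounded, rho_range.
  - intros m; rewrite Cmod_mult, Cmod_pow, Rmult_comm.
    apply Rmult_le_compat_r; auto; apply rho_pow_range.
Qed.

Lemma is_heine N : is_sum_over every (fun m => q ^ m * inv_pair N m) (heine N).
Proof. apply tsum_correct, heine_summable. Qed.

(** A closed form of the increments of [inv_pair N], which makes its limit a
    series. *)
Definition inv_pair_step (N m : nat) : C :=
  q ^ m * (1 + q ^ N - q ^ (m + N)) * inv_pair N m.

Lemma inv_pair_step_0 N : inv_pair_step N 0 = inv_pair N 0.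
Proof. unfold inv_pair_step; simpl; ring. Qed.

Lemma inv_pair_step_S N m : inv_pair_step N (S m) = inv_pair N (S m) - inv_pair N m.
Proof.
  unfold inv_pair_step, inv_pair; rewrite (inv_qfact_S m), (inv_qfact_S (m + N)).
  change (S m + N)%nat with (S (m + N)).
  change (S (m + N)) with (S m + N)%nat; rewrite !(Cpow_add_r q (S m) N); ring.
Qed.

Lemma inv_pair_step_bounded : exists K, (0 <= K)%R /\
  forall N m, (Cmod (inv_pair_step N m) <= K * rho ^ m)%R.
Proof.
  destruct inv_pair_bounded as [K [HK0 HK]]; exists (3 * K)%R; split; [lra|].
  intros N m; unfold inv_pair_step; rewrite !Cmod_mult, Cmod_pow; fold rho.
  assert (Cmod (1 + q ^ N - q ^ (m + N)) <= 3)%R.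
  { eapply Rle_trans; [apply Cmod_triangle|].
    rewrite Cmod_opp, Cmod_pow.
    pose proof (Cmod_triangle 1 (q ^ N)) as H.
    rewrite Cmod_1, Cmod_pow in H; fold rho in H; fold rho.
    pose proof (rho_pow_range N); pose proof (rho_pow_range (m + N)); lra. }
  pose proof (rho_pow_range m).
  replace (3 * K * rho ^ m)%R with (rho ^ m * 3 * K)%R by ring.
  apply Rmult_le_compat; auto using Cmod_ge_0.
  - apply Rmult_le_pos; [lra|apply Cmod_ge_0].
  - apply Rmult_le_compat_l; lra.
Qed.

Lemma inv_pair_step_summable N : abs_summable (inv_pair_step N).
Proof.
  destruct inv_pair_step_bounded as [K [HK0 HK]].
  apply (abs_summable_dominated _ (fun r => rho ^ r)%R K); auto.
  apply geometric_sums_bounded, rho_range.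
Qed.

Lemma inv_pair_step_sum N : is_sum_over every (inv_pair_step N) (W * W).
Proof.
  apply is_sum_over_of_partial; [apply inv_pair_step_summable|].
  assert (E : forall n, bsum (inv_pair_step N) (S n) = inv_pair N n).
  { induction n as [|n IH].
    - rewrite bsum_S, bsum_0, inv_pair_step_0; ring.
    - rewrite bsum_S, IH, inv_pair_step_S; ring. }
  assert (H : tends (inv_pair N) (W * W)).
  { apply tends_mult; auto.
    apply (tends_subseq inv_qfact W (fun m => m + N)%nat); auto; intros; lia. }
  intros eps He; destruct (H eps He) as [n0 Hn]; exists (S n0).
  intros [|n] Hle; [lia|]; rewrite E; apply Hn; lia.
Qed.

(** The two series add up termwise to the telescoping series for [N+1]. *)
Lemma heine_rec N : heine N + q ^ S N * heine (S N) = W * W.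
Proof.
  eapply is_sum_over_unique; [|apply (inv_pair_step_sum (S N))].
  eapply is_sum_over_ext.
  2: { apply is_sum_over_plus; [apply is_heine|].
       apply is_sum_over_scal, is_heine. }
  intros m _; unfold inv_pair_step, inv_pair; simpl.
  rewrite (inv_qfact_S (m + N)), Nat.add_succ_r.
  rewrite Cpow_S, (Cpow_add_r q m N); ring.
Qed.

(** Heine's transformation in a case where it follows from recurrences alone.
    Both sides satisfy [x N = 1 - q^(N+1) * x (N+1)], so that their difference
    [D] satisfies [D N = - q^(N+1) * D (N+1)].  Being bounded uniformly in [N],
    it vanishes. *)
Lemma theta_heine N : theta (S N) = J * J * heine N.
Proof.
  set (D := fun N => J * J * heine N - theta (S N)).
  assert (HD : forall N, D N = - q ^ S N * D (S N)).
  { intros M; unfold D; rewrite (theta_rec (S M)) by lia.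
    replace (heine M) with (W * W - q ^ S M * heine (S M))
      by (rewrite <- (heine_rec M); ring).
    replace (J * J * (W * W - q ^ S M * heine (S M)))
      with ((J * W) * (J * W) - q ^ S M * (J * J * heine (S M))) by ring.
    rewrite J_mult_W; ring. }
  pose proof rho_range as Hr.
  assert (Hb : exists K, (0 <= K)%R /\ forall N, (Cmod (D N) <= K)%R).
  { destruct inv_pair_bounded as [K [HK0 HK]].
    pose proof (geometric_sums_bounded rho rho_range) as [M HM].
    assert (HM0 : (0 <= M)%R) by apply (HM [] (NoDup_nil _)).
    exists (Cmod (J * J) * (K * M) + M)%R; split.
    { pose proof (Cmod_ge_0 (J * J)).
      assert (0 <= K * M)%R by nra; nra. }
    intros M'; unfold D.
    eapply Rle_trans; [apply Cmod_triangle|]; rewrite Cmod_opp, Cmod_mult.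
    apply Rplus_le_compat.
    - apply Rmult_le_compat_l; [apply Cmod_ge_0|].
      apply (Cmod_sum_le _ _ _ (is_heine M')); intros L HL.
      eapply Rle_trans.
      + apply (Rsum_le _ (fun m => K * rho ^ m)%R); intros m.
        rewrite Cmod_mult, Cmod_pow, Rmult_comm.
        apply Rmult_le_compat_r; auto; apply rho_pow_range.
      + rewrite Rsum_scal; apply Rmult_le_compat_l; auto.
    - apply (Cmod_sum_le _ _ _ (is_theta (S M') ltac:(lia))); intros L HL.
      eapply Rle_trans; [|apply (HM L HL)].
      apply Rsum_le; intros m; apply Cmod_monomial; lia. }
  destruct Hb as [K [HK0 HK]].
  assert (Hn : forall n N, (Cmod (D N) <= rho ^ n * K)%R).
  { induction n as [|n IH]; intros M; [simpl; rewrite Rmult_1_l; auto|].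
    rewrite HD, Cmod_mult, Cmod_opp, Cmod_pow; fold rho.
    specialize (IH (S M)).
    pose proof (rho_pow_S_le M); pose proof (rho_pow_range n).
    pose proof (rho_pow_range (S M)).
    simpl (rho ^ S n)%R; rewrite Rmult_assoc.
    apply Rmult_le_compat; auto using Cmod_ge_0; lra. }
  assert (H0 : D N = 0).
  { apply Cmod_eq_0, Rle_antisym; [|apply Cmod_ge_0].
    apply le_epsilon; intros eps He.
    assert (Hr' : (Rabs rho < 1)%R) by (rewrite Rabs_pos_eq; lra).
    assert (He' : (0 < eps / (K + 1))%R) by (apply Rdiv_lt_0_compat; lra).
    pose proof (pow_lt_1_zero rho Hr' _ He') as [n0 Hn0].
    specialize (Hn0 n0 (Nat.le_refl _)).
    rewrite Rabs_pos_eq in Hn0 by apply rho_pow_range.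
    specialize (Hn n0 N).
    assert (eps / (K + 1) * (K + 1) = eps)%R by (field; lra).
    pose proof (rho_pow_range n0); nra. }
  unfold D in H0.
  replace (theta (S N)) with (J * J * heine N - (J * J * heine N - theta (S N)))
    by ring.
  rewrite H0; ring.
Qed.

(** * A finite identity *)

Ltac qring :=
  cbn [tri Nat.add Nat.mul];
  repeat rewrite ?Nat.add_succ_r, ?Nat.mul_succ_r, ?Nat.add_0_r, ?Nat.mul_0_r,
    ?Cpow_add_r, ?Cpow_S;
  ring.

Lemma Cmult_cancel_l (a x y : C) : a <> 0 -> a * x = a * y -> x = y.
Proof.
  intros Ha H; replace x with (/ a * (a * x)) by (field; auto).
  rewrite H; field; auto.
Qed.

(** A weighted sum over row [N] of the Gaussian binomial coefficients, divided by
    [(q)_N]. *)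
Definition conv (c : nat -> C) (N : nat) : C :=
  bsum (fun k => c k * (inv_qfact k * inv_qfact (N - k))) (S N).

Lemma conv_ext (c d : nat -> C) N :
  (forall k, (k <= N)%nat -> c k = d k) -> conv c N = conv d N.
Proof.
  intros H; apply bsum_ext; intros k Hk; rewrite (H k); [reflexivity|lia].
Qed.

Lemma conv_plus (c d : nat -> C) N : conv (fun k => c k + d k) N
  = conv c N + conv d N.
Proof.
  unfold conv; rewrite <- bsum_plus; apply bsum_ext; intros; ring.
Qed.

Lemma conv_scal x (c : nat -> C) N : conv (fun k => x * c k) N = x * conv c N.
Proof.
  unfold conv; rewrite <- bsum_scal; apply bsum_ext; intros; ring.
Qed.

Lemma conv_rev (c : nat -> C) N : conv (fun k => c (N - k)%nat) N = conv c N.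
Proof.
  unfold conv;
      rewrite <- (bsum_rev (fun k => c k * (inv_qfact k * inv_qfact (N - k)))).
  apply bsum_ext; intros k Hk.
  replace (S N - 1 - k)%nat with (N - k)%nat by lia.
  replace (N - (N - k))%nat with k by lia; ring.
Qed.

(** The q-Pascal rule, with a decomposition of [1 - q^(N+1)] that may depend on
    [k]; each of the two factors turns an inverse of [(q)_k] or [(q)_(N+1-k)]
    into the preceding one. *)
Lemma conv_pascal (c A B : nat -> C) N :
  (forall k, (k <= S N)%nat ->
    1 - q ^ S N = A k * (1 - q ^ (S N - k)) + B k * (1 - q ^ k)) ->
  (1 - q ^ S N) * conv c (S N)
  = conv (fun k => A k * c k) N + conv (fun k => B (S k) * c (S k)) N.
Proof.
  intros HAB; unfold conv; rewrite <- bsum_scal.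
  rewrite (bsum_ext _ (fun k =>
    A k * c k * (inv_qfact k * ((1 - q ^ (S N - k)) * inv_qfact (S N - k)))
    + B k * c k * ((1 - q ^ k) * inv_qfact k * inv_qfact (S N - k)))).
  2: { intros k Hk; rewrite (HAB k) by lia; ring. }
  rewrite bsum_plus; f_equal.
  - rewrite bsum_S, Nat.sub_diag.
    replace (1 - q ^ 0) with (RtoC 0) by (simpl; ring).
    match goal with |- ?x + ?y = _ => replace y with (RtoC 0) by ring end.
    rewrite Cplus_0_r; apply bsum_ext; intros k Hk.
    replace (S N - k)%nat with (S (N - k)) by lia; now rewrite <- inv_qfact_S.
  - rewrite bsum_first.
    replace (1 - q ^ 0) with (RtoC 0) by (simpl; ring).
    match goal with |- ?x + ?y = _ => replace x with (RtoC 0) by ring end.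
    rewrite Cplus_0_l; apply bsum_ext; intros k Hk.
    now rewrite <- inv_qfact_S.
Qed.

(** Row [2n+1] is symmetric about the gap between [n] and [n+1]: the positions
    [n-R] and [n+1+R] have the same weight. *)
Lemma conv_fold_odd (c : nat -> C) n :
  conv c (2 * n + 1)
  = bsum (fun R => (c (n - R)%nat + c (n + 1 + R)%nat) * inv_pair (2 * R + 1) (n - R))
      (S n).
Proof.
  unfold conv; replace (S (2 * n + 1)) with (S n + S n)%nat by lia.
  rewrite bsum_split, <- (bsum_rev _ (S n)), <- bsum_plus.
  apply bsum_ext; intros R HR; unfold inv_pair.
  replace (S n - 1 - R)%nat with (n - R)%nat by lia.
  replace (2 * n + 1 - (n - R))%nat with (n + 1 + R)%nat by lia.
  replace (S n + R)%nat with (n + 1 + R)%nat by lia.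
  replace (2 * n + 1 - (n + 1 + R))%nat with (n - R)%nat by lia.
  replace (n - R + (2 * R + 1))%nat with (n + 1 + R)%nat by lia; ring.
Qed.

(** Row [2n] is symmetric about [n], a position that is its own mirror image and
    is therefore counted once. *)
Lemma conv_fold_even (c : nat -> C) n :
  conv c (2 * n)
  = bsum (fun R => (c (n - R)%nat +
      match R with O => RtoC 0 | S _ => c (n + R)%nat end) * inv_pair (2 * R) (n - R))
      (S n).
Proof.
  unfold conv; replace (S (2 * n)) with (S n + n)%nat by lia.
  rewrite bsum_split, <- (bsum_rev _ (S n)).
  set (d := fun R => match R with O => RtoC 0
    | S _ => c (n + R)%nat * inv_pair (2 * R) (n - R) end).
  replace (bsum (fun k => _) n) with (bsum d (S n)).
  - rewrite <- bsum_plus; apply bsum_ext; intros R HR; unfold d, inv_pair.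
    replace (S n - 1 - R)%nat with (n - R)%nat by lia.
    replace (2 * n - (n - R))%nat with (n + R)%nat by lia.
    replace (n - R + 2 * R)%nat with (n + R)%nat by lia.
    destruct R; ring.
  - rewrite bsum_first; unfold d at 1; rewrite Cplus_0_l.
    apply bsum_ext; intros R HR; unfold d, inv_pair.
    replace (S n + R)%nat with (n + S R)%nat by lia.
    replace (2 * n - (n + S R))%nat with (n - S R)%nat by lia.
    replace (n - S R + 2 * S R)%nat with (n + S R)%nat by lia; ring.
Qed.

(** The sum of [q^(r s)] over [r + s = m - 1], which arises when the terms of the
    double sum are collected by [r + s]. *)
Definition inner (m : nat) : C := bsum (fun s => q ^ (s * (m - 1 - s))) m.

Lemma inner_0 : inner 0 = 0.
Proof. reflexivity. Qed.

Lemma inner_1 : inner 1 = 1.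
Proof. unfold inner; rewrite bsum_S, bsum_0; simpl; ring. Qed.

(** The first and the last summand are 1; the exponents of the others factor
    since [(s+1) (m-s) = s (m-1-s) + m]. *)
Lemma inner_rec m : inner (S (S m)) = 2 + q ^ m * inner m.
Proof.
  unfold inner; rewrite bsum_first, bsum_S, <- bsum_scal.
  rewrite (bsum_ext _ (fun k => q ^ m * q ^ (k * (m - 1 - k)))).
  - replace (S (S m) - 1 - S m)%nat with 0%nat by lia.
    rewrite Nat.mul_0_r; simpl; ring.
  - intros k Hk; rewrite <- Cpow_add_r; f_equal.
    replace (S (S m) - 1 - S k)%nat with (S (m - 1 - k)) by lia; nia.
Qed.

(** The bound is the fixed point of [x -> 2 + rho * x]. *)
Lemma inner_bounded : exists K, (0 <= K)%R /\ forall m, (Cmod (inner m) <= K)%R.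
Proof.
  pose proof rho_range as Hr.
  assert (Hc : (0 < / (1 - rho))%R) by (apply Rinv_0_lt_compat; lra).
  assert (HK : (2 + rho * (2 * / (1 - rho)) = 2 * / (1 - rho))%R) by (field; lra).
  exists (2 * / (1 - rho))%R; split; [lra|].
  assert (H : forall m, (Cmod (inner m) <= 2 * / (1 - rho))%R
    /\ (Cmod (inner (S m)) <= 2 * / (1 - rho))%R); [|apply H].
  induction m as [|m [IH1 IH2]].
  - rewrite inner_0, inner_1, Cmod_0, Cmod_1; split; nra.
  - split; auto; rewrite inner_rec.
    eapply Rle_trans; [apply Cmod_triangle|].
    rewrite Cmod_R, Rabs_pos_eq, Cmod_mult, Cmod_pow by lra; fold rho.
    destruct m as [|m].
    + rewrite inner_0, Cmod_0; nra.
    + rewrite <- HK; apply Rplus_le_compat_l.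
      apply Rmult_le_compat; auto using Cmod_ge_0.
      * apply rho_pow_range.
      * apply rho_pow_S_le.
Qed.

Definition sgn (n : nat) : C := (- RtoC 1) ^ n.

(** The coefficients of the finite identity.  At [z >= 0] they are those of the
    double sum at [(q, q)]; the values at [z < 0] are forced by the recurrence
    [ecoef z - q^(3z-2) * ecoef (z-2) = 2 * (-1)^z * q^(z(z+1)/2)], and make
    [z -> -2-z] a reflection ([ecoef_reflect]). *)
Definition ecoef (z : Z) : C :=
  if (0 <=? z)%Z
  then let R := Z.to_nat z in sgn R * q ^ tri (S R) * inner (S R)
  else let p := Z.to_nat (-1 - z) in sgn p * q ^ (tri (S p) + p) * inner p.

Lemma ecoef_nonneg R :
  ecoef (Z.of_nat R) = sgn R * q ^ tri (S R) * inner (S R).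
Proof.
  unfold ecoef; rewrite (proj2 (Z.leb_le 0 (Z.of_nat R))) by lia.
  now rewrite Nat2Z.id.
Qed.

Lemma ecoef_neg p :
  ecoef (-1 - Z.of_nat p) = sgn p * q ^ (tri (S p) + p) * inner p.
Proof.
  unfold ecoef; rewrite (proj2 (Z.leb_gt 0 (-1 - Z.of_nat p))) by lia.
  now replace (Z.to_nat (-1 - (-1 - Z.of_nat p))) with p by lia.
Qed.

Lemma sgn_S n : sgn (S n) = - sgn n.
Proof. unfold sgn; rewrite Cpow_S; ring. Qed.

Lemma ecoef_reflect p :
  ecoef (-1 - Z.of_nat p) = - q ^ (2 * p) * ecoef (Z.of_nat p - 1).
Proof.
  rewrite ecoef_neg; destruct p as [|p].
  - rewrite inner_0; change (Z.of_nat 0 - 1)%Z with (-1 - Z.of_nat 0)%Z.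
    rewrite ecoef_neg, inner_0; ring.
  - replace (Z.of_nat (S p) - 1)%Z with (Z.of_nat p) by lia.
    rewrite ecoef_nonneg, sgn_S; qring.
Qed.

(** The recurrence of [inner], read backwards, expresses the value at [-R] by
    [inner (S R)] instead of [inner (R - 1)]; in this form it also holds at
    [R = 0]. *)
Lemma ecoef_opp R :
  ecoef (- Z.of_nat R) = - sgn R * q ^ tri R * (inner (S R) - 2).
Proof.
  destruct R as [|R].
  - change (- Z.of_nat 0)%Z with (Z.of_nat 0).
    rewrite ecoef_nonneg, inner_1; simpl; ring.
  - replace (- Z.of_nat (S R))%Z with (-1 - Z.of_nat R)%Z by lia.
    rewrite ecoef_neg, inner_rec, sgn_S; qring.
Qed.

(** The q-Pascal rule leaves, next to the sum over row [2n], a sum that changes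
    sign under [k -> 2n-k]. *)
Lemma finite_odd_of_even n :
  (1 - q ^ S (2 * n)) * conv (fun k => ecoef (Z.of_nat n - Z.of_nat k)) (S (2 * n))
  = conv (fun k => ecoef (Z.of_nat n - Z.of_nat k)) (2 * n).
Proof.
  rewrite (conv_pascal _ (fun _ => 1) (fun k => q ^ (S (2 * n) - k))).
  2: { intros k Hk.
       replace (q ^ S (2 * n)) with (q ^ (S (2 * n) - k) * q ^ k); [ring|].
       rewrite <- Cpow_add_r; f_equal; lia. }
  rewrite (conv_ext (fun k => 1 * _) (fun k => ecoef (Z.of_nat n - Z.of_nat k)))
    by (intros; ring).
  set (Y := fun k => q ^ (S (2 * n) - S k) * ecoef (Z.of_nat n - Z.of_nat (S k))).
  assert (HY : conv Y (2 * n) = - conv Y (2 * n)).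
  { replace (- conv Y (2 * n)) with (-1 * conv Y (2 * n)) by ring.
    rewrite <- (conv_rev Y) at 1; rewrite <- conv_scal.
    apply conv_ext; intros k Hk; unfold Y.
    destruct (Nat.le_ge_cases k n) as [Hkn|Hkn].
    - replace (Z.of_nat n - Z.of_nat (S (2 * n - k)))%Z
        with (-1 - Z.of_nat (n - k))%Z by lia.
      replace (Z.of_nat n - Z.of_nat (S k))%Z with (Z.of_nat (n - k) - 1)%Z by lia.
      rewrite ecoef_reflect.
      replace (S (2 * n) - S k)%nat
        with (S (2 * n) - S (2 * n - k) + 2 * (n - k))%nat by lia.
      rewrite Cpow_add_r; ring.
    - replace (Z.of_nat n - Z.of_nat (S (2 * n - k)))%Z
        with (Z.of_nat (k - n) - 1)%Z by lia.
      replace (Z.of_nat n - Z.of_nat (S k))%Z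
        with (-1 - Z.of_nat (k - n))%Z by lia.
      rewrite ecoef_reflect.
      replace (S (2 * n) - S (2 * n - k))%nat
        with (S (2 * n) - S k + 2 * (k - n))%nat by lia.
      rewrite Cpow_add_r; ring. }
  assert (HY0 : conv Y (2 * n) = 0).
  { assert (H2 : 2 * conv Y (2 * n) = 0).
    { replace (2 * conv Y (2 * n)) with (conv Y (2 * n) + conv Y (2 * n)) by ring.
      rewrite HY at 2; ring. }
    apply (Cmult_cancel_l 2); [intros E; apply RtoC_inj in E; lra|].
    rewrite H2; ring. }
  match goal with |- ?x + _ = _ => change (x + conv Y (2 * n) = x) end.
  rewrite HY0; ring.
Qed.

(** The q-Pascal rule leaves the sum over row [2n+1] and an error term.  The
    claim is that this error is [- q^(n+1)] times the same sum, which holds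
    because the coefficients at mirror positions of row [2n+1] cancel. *)
Lemma finite_even_of_odd n :
  (1 - q ^ S (2 * n + 1))
    * conv (fun k => ecoef (Z.of_nat (S n) - Z.of_nat k)) (S (2 * n + 1))
  = (1 - q ^ S n) * conv (fun k => ecoef (Z.of_nat n - Z.of_nat k)) (2 * n + 1).
Proof.
  rewrite (conv_pascal _ (fun k => q ^ k) (fun _ => 1)).
  2: { intros k Hk.
       replace (q ^ S (2 * n + 1)) with (q ^ (S (2 * n + 1) - k) * q ^ k); [ring|].
       rewrite <- Cpow_add_r; f_equal; lia. }
  rewrite (conv_ext (fun k => 1 * _) (fun k => ecoef (Z.of_nat n - Z.of_nat k))).
  2: { intros k _; rewrite Cmult_1_l; f_equal; lia. }
  set (X := conv (fun k => ecoef (Z.of_nat n - Z.of_nat k)) (2 * n + 1)).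
  assert (HZ : conv (fun k => q ^ k * ecoef (Z.of_nat (S n) - Z.of_nat k)
    + q ^ S n * ecoef (Z.of_nat n - Z.of_nat k)) (2 * n + 1) = 0).
  { rewrite conv_fold_odd. apply bsum_zero; intros R HR.
    match goal with |- ?x * _ = _ => replace x with (RtoC 0); [ring|] end.
    replace (Z.of_nat (S n) - Z.of_nat (n - R))%Z with (Z.of_nat (S R)) by lia.
    replace (Z.of_nat n - Z.of_nat (n - R))%Z with (Z.of_nat R) by lia.
    replace (Z.of_nat (S n) - Z.of_nat (n + 1 + R))%Z with (- Z.of_nat R)%Z by lia.
    replace (Z.of_nat n - Z.of_nat (n + 1 + R))%Z with (-1 - Z.of_nat R)%Z by lia.
    rewrite !ecoef_nonneg, ecoef_opp, ecoef_neg, inner_rec, sgn_S.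
    replace (S n) with (n - R + R + 1)%nat by lia.
    replace (n + 1 + R)%nat with (n - R + R + 1 + R)%nat by lia.
    qring. }
  rewrite conv_plus, conv_scal in HZ; fold X in HZ.
  replace ((1 - q ^ S n) * X) with (X - q ^ S n * X) by ring.
  match goal with |- ?x + X = _ => replace x with (- (q ^ S n * X)); [ring|] end.
  match goal with |- - ?y = ?x => replace x with (x + y - y) by ring end.
  rewrite HZ; ring.
Qed.

Lemma finite_odd_of_finite_even n :
  conv (fun k => ecoef (Z.of_nat n - Z.of_nat k)) (2 * n)
      = qfact n * inv_qfact (2 * n) ->
  conv (fun k => ecoef (Z.of_nat n - Z.of_nat k)) (2 * n + 1)
  = qfact n * inv_qfact (2 * n + 1).
Proof.
  intros H; rewrite <- finite_odd_of_even, inv_qfact_S in H.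
  rewrite Nat.add_1_r; apply (Cmult_cancel_l (1 - q ^ S (2 * n)));
    [apply one_minus_pow_neq_0|].
  rewrite H; ring.
Qed.

Lemma finite_even n :
  conv (fun k => ecoef (Z.of_nat n - Z.of_nat k)) (2 * n)
      = qfact n * inv_qfact (2 * n).
Proof.
  induction n as [|n IH].
  - unfold conv; simpl (2 * 0)%nat; rewrite bsum_S, bsum_0.
    change (Z.of_nat 0 - Z.of_nat 0)%Z with (Z.of_nat 0).
    rewrite ecoef_nonneg, inner_1, Nat.sub_diag, inv_qfact_0.
    unfold qfact, qpoch, sgn; simpl; ring.
  - apply finite_odd_of_finite_even in IH.
    pose proof (finite_even_of_odd n) as H; rewrite IH in H.
    replace (2 * S n)%nat with (S (2 * n + 1)) by lia.
    apply (Cmult_cancel_l (1 - q ^ S (2 * n + 1)));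
      [apply one_minus_pow_neq_0|].
    rewrite H, qfact_S, (inv_qfact_S (2 * n + 1)); ring.
Qed.

Lemma finite_odd n :
  conv (fun k => ecoef (Z.of_nat n - Z.of_nat k)) (2 * n + 1)
  = qfact n * inv_qfact (2 * n + 1).
Proof. apply finite_odd_of_finite_even, finite_even. Qed.

(** * Summation over a triangle *)

Lemma ecoef_bound : exists K, (0 <= K)%R /\ forall R,
  (Cmod (ecoef (Z.of_nat R)) <= K * rho ^ R)%R /\
  (Cmod (ecoef (-1 - Z.of_nat R)) <= K * rho ^ S R)%R.
Proof.
  destruct inner_bounded as [K [HK0 HK]]; exists K; split; auto; intros R.
  assert (Hs : forall n, Cmod (sgn n) = 1%R).
  { intros n; unfold sgn; now rewrite Cmod_pow, Cmod_m1, pow1. }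
  pose proof rho_range.
  rewrite ecoef_nonneg, ecoef_neg, !Cmod_mult, !Hs, !Cmod_pow, !Rmult_1_l.
  fold rho; split; rewrite Rmult_comm.
  - apply Rmult_le_compat; auto using Cmod_ge_0; [apply rho_pow_range|].
    apply pow_antitone; [lra|simpl; lia].
  - destruct R as [|R].
    + rewrite inner_0, Cmod_0, Rmult_0_l.
      apply Rmult_le_pos; [auto|apply rho_pow_range].
    + apply Rmult_le_compat; auto using Cmod_ge_0; [apply rho_pow_range|].
      apply pow_antitone; [lra|simpl; lia].
Qed.

Lemma geometric_prod_summable (f : nat * nat -> C) K :
  (0 <= K)%R ->
  (forall r m, Cmod (f (r, m)) <= K * (rho ^ r * rho ^ m))%R -> abs_summable f.
Proof.
  intros HK Hf.
  apply (abs_summable_dominated _ (fun p => rho ^ fst p * rho ^ snd p)%R K).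
  - apply (sums_bounded_prod (fun n => rho ^ n)%R (fun n => rho ^ n)%R);
      try apply geometric_sums_bounded, rho_range; intros; apply rho_pow_range.
  - auto.
  - intros [r m]; apply Hf.
Qed.

(** Expanding [theta] by [theta_heine] gives a family over the pairs [(R, m)];
    its sums along rows and along antidiagonals are the two series. *)
Lemma bailey_transform (a : nat -> C) c K :
  (0 <= K)%R -> (forall R, Cmod (a R) <= K * rho ^ R)%R ->
  exists L,
    is_sum_over every (fun n =>
      q ^ n * bsum (fun R => a R * inv_pair (2 * R + c) (n - R)) (S n)) L /\
    is_sum_over every (fun R => a R * q ^ R * theta (2 * R + c + 1)) (J * J * L).
Proof.
  intros HK Ha.
  set (f := fun p : nat * nat => let (R, m) := p in
    a R * q ^ R * (q ^ m * inv_pair (2 * R + c) m)).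
  destruct inv_pair_bounded as [B [HB0 HB]].
  assert (Hf : abs_summable f).
  { apply (geometric_prod_summable _ (K * B)); [nra|].
    intros r m; unfold f; rewrite !Cmod_mult, !Cmod_pow; fold rho.
    specialize (Ha r); specialize (HB (2 * r + c)%nat m).
    pose proof (rho_pow_range r); pose proof (rho_pow_range m).
    replace (K * B * (rho ^ r * rho ^ m))%R
      with ((K * rho ^ r) * 1 * (rho ^ m * B))%R by ring.
    apply Rmult_le_compat; auto using Cmod_ge_0.
    - apply Rmult_le_pos; [apply Cmod_ge_0|lra].
    - apply Rmult_le_pos; [lra|apply Cmod_ge_0].
    - apply Rmult_le_compat; auto using Cmod_ge_0; lra.
    - apply Rmult_le_compat_l; lra. }
  destruct (abs_summable_ex f Hf) as [L HL]; exists L; split.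
  - eapply is_sum_over_ext; [|apply is_sum_over_antidiagonal, HL].
    intros n _; simpl; rewrite <- bsum_scal; apply bsum_ext; intros R HR.
    replace (q ^ n) with (q ^ R * q ^ (n - R)); [ring|].
    rewrite <- Cpow_add_r; f_equal; lia.
  - apply (is_sum_over_fst f (fun R => a R * q ^ R * heine (2 * R + c))) in HL.
    + apply (is_sum_over_scal _ _ (J * J)) in HL.
      eapply is_sum_over_ext; [|exact HL].
      intros R _; simpl; rewrite Nat.add_1_r, theta_heine; simpl; ring.
    + intros R; apply is_sum_over_scal, is_heine.
Qed.

(** Passing to the limit under the sign of summation.  The increments of [b] are
    the antidiagonal sums of [a R * inv_pair_step (2 R) m], whose row sums are
    [a R * W^2], so that the exchange of limit and sum is again an exchange of
    summations. *)
Lemma bailey_limit (a b : nat -> C) B K :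
  (0 <= K)%R -> (forall R, Cmod (a R) <= K * rho ^ R)%R ->
  (forall n, bsum (fun R => a R * inv_pair (2 * R) (n - R)) (S n) = b n) ->
  tends b B -> is_sum_over every a (J * J * B).
Proof.
  intros HK Ha Hab Hb.
  set (f := fun p : nat * nat => let (R, m) := p in a R * inv_pair_step (2 * R) m).
  destruct inv_pair_step_bounded as [D [HD0 HD]].
  assert (Hf : abs_summable f).
  { apply (geometric_prod_summable _ (K * D)); [nra|].
    intros r m; unfold f; rewrite !Cmod_mult.
    replace (K * D * (rho ^ r * rho ^ m))%R
      with ((K * rho ^ r) * (D * rho ^ m))%R by ring.
    apply Rmult_le_compat; auto using Cmod_ge_0. }
  destruct (abs_summable_ex f Hf) as [L HL].
  assert (EL : L = B).
  { apply is_sum_over_antidiagonal, bsum_tends in HL.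
    apply (tends_subseq _ _ S) in HL; [|intros; lia].
    eapply tends_unique; [exact HL|].
    eapply tends_ext; [|exact Hb].
    intros n; rewrite <- Hab; unfold f; symmetry; induction n as [|n IH].
    - rewrite !bsum_S, !bsum_0, Nat.sub_diag, inv_pair_step_0; ring.
    - rewrite (bsum_S _ (S n)), IH, !(bsum_S _ (S n)), Nat.sub_diag, inv_pair_step_0.
      rewrite Cplus_assoc; f_equal; rewrite <- bsum_plus.
      apply bsum_ext; intros R HR.
      replace (S n - R)%nat
          with (S (n - R)) by lia; rewrite inv_pair_step_S; ring. }
  subst L.
  apply (is_sum_over_fst f (fun R => a R * (W * W))) in HL.
  - apply (is_sum_over_scal _ _ (J * J)) in HL.
    eapply is_sum_over_ext; [|exact HL].
    intros R _; simpl.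
    replace (J * J * (a R * (W * W))) with (a R * ((J * W) * (J * W))) by ring.
    rewrite J_mult_W; ring.
  - intros R; apply is_sum_over_scal, inv_pair_step_sum.
Qed.

(** * Double and triple sums *)

(** The terms of the Hecke-type double sum of parameters [1, 2, 1] at
    [(q^i, q^j)]. *)
Definition term2 (i j : nat) (p : nat * nat) : C :=
  monomial i (fst p) * monomial j (snd p) * q ^ (2 * (fst p * snd p)).

(** The terms of the triple sum at [(q^i, q^j, q^k)] over nonnegative indices. *)
Definition term3 (i j k : nat) (p : nat * nat * nat) : C :=
  term2 i j (fst p) * monomial k (snd p)
  * q ^ (2 * ((fst (fst p) + snd (fst p)) * snd p)).

Definition double_sum (i j : nat) : C := tsum (term2 i j).

Definition triple_sum (i j k : nat) : C := tsum (term3 i j k).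

Lemma Cmod_mult_pow_le x n B : (Cmod x <= B)%R -> (Cmod (x * q ^ n) <= B)%R.
Proof.
  intros H; rewrite Cmod_mult, Cmod_pow; fold rho.
  pose proof (rho_pow_range n); pose proof (Cmod_ge_0 x); nra.
Qed.

Lemma Cmod_term2 i j r s :
  (1 <= i)%nat -> (1 <= j)%nat ->
  (Cmod (term2 i j (r, s)) <= rho ^ r * rho ^ s)%R.
Proof.
  intros Hi Hj; unfold term2; cbn [fst snd]; apply Cmod_mult_pow_le.
  rewrite Cmod_mult; apply Rmult_le_compat; auto using Cmod_ge_0, Cmod_monomial.
Qed.

Lemma is_double_sum i j :
  (1 <= i)%nat -> (1 <= j)%nat -> is_sum_over every (term2 i j) (double_sum i j).
Proof.
  intros Hi Hj; apply tsum_correct.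
  apply (geometric_prod_summable _ 1); [lra|]; intros r s.
  rewrite Rmult_1_l; now apply Cmod_term2.
Qed.

Lemma is_triple_sum i j k :
  (1 <= i)%nat -> (1 <= j)%nat -> (1 <= k)%nat ->
  is_sum_over every (term3 i j k) (triple_sum i j k).
Proof.
  intros Hi Hj Hk; apply tsum_correct.
  apply (abs_summable_dominated _
    (fun p => (rho ^ fst (fst p) * rho ^ snd (fst p)) * rho ^ snd p)%R 1).
  - apply (sums_bounded_prod (fun p => rho ^ fst p * rho ^ snd p)%R
      (fun n => rho ^ n)%R).
    + intros; apply Rmult_le_pos; apply rho_pow_range.
    + intros; apply rho_pow_range.
    + apply (sums_bounded_prod (fun n => rho ^ n)%R (fun n => rho ^ n)%R);
        try apply geometric_sums_bounded, rho_range; intros; apply rho_pow_range.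
    + apply geometric_sums_bounded, rho_range.
  - lra.
  - intros [[r s] t]; rewrite Rmult_1_l; unfold term3; cbn [fst snd].
    apply Cmod_mult_pow_le; rewrite Cmod_mult.
    apply Rmult_le_compat; auto using Cmod_ge_0, Cmod_monomial, Cmod_term2.
Qed.

Lemma triple_sum_swap12 i j k :
  (1 <= i)%nat -> (1 <= j)%nat -> (1 <= k)%nat -> triple_sum i j k
      = triple_sum j i k.
Proof.
  intros Hi Hj Hk.
  apply (is_sum_over_unique every (term3 i j k)); [now apply is_triple_sum|].
  apply (is_sum_over_reindex
    (fun p : nat * nat * nat => (snd (fst p), fst (fst p), snd p))).
  - intros [[a b] c] [[a' b'] c']; cbn [fst snd]; congruence.
  - intros; exact Logic.I.
  - intros [[a b] c] _; left; now exists (b, a, c).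
  - eapply is_sum_over_ext; [|now apply is_triple_sum].
    intros [[a b] c] _; unfold term3, term2; cbn [fst snd].
    rewrite (Nat.mul_comm a b), (Nat.add_comm a b); ring.
Qed.

Lemma triple_sum_swap23 i j k :
  (1 <= i)%nat -> (1 <= j)%nat -> (1 <= k)%nat -> triple_sum i j k
      = triple_sum i k j.
Proof.
  intros Hi Hj Hk.
  apply (is_sum_over_unique every (term3 i j k)); [now apply is_triple_sum|].
  apply (is_sum_over_reindex
    (fun p : nat * nat * nat => (fst (fst p), snd p, snd (fst p)))).
  - intros [[a b] c] [[a' b'] c']; cbn [fst snd]; congruence.
  - intros; exact Logic.I.
  - intros [[a b] c] _; left; now exists (a, c, b).
  - eapply is_sum_over_ext; [|now apply is_triple_sum].
    intros [[a b] c] _; unfold term3, term2; cbn [fst snd].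
    rewrite !Nat.mul_add_distr_r, !Nat.mul_add_distr_l, !Cpow_add_r.
    rewrite (Nat.mul_comm b c); ring.
Qed.

Lemma double_sum_by_second i j :
  (1 <= i)%nat -> (1 <= j)%nat ->
  is_sum_over every (fun s => monomial j s * theta (i + 2 * s)) (double_sum i j).
Proof.
  intros Hi Hj; apply (is_sum_over_snd (term2 i j)); [now apply is_double_sum|].
  intros s; eapply is_sum_over_ext; [|apply is_sum_over_scal, is_theta; lia].
  intros r _; unfold term2; cbn [fst snd]; rewrite monomial_shift.
  replace (2 * s * r)%nat with (2 * (r * s))%nat by lia; ring.
Qed.

Lemma double_sum_shift i j :
  (1 <= i)%nat -> (1 <= j)%nat ->
  double_sum i j = theta i - q ^ j * double_sum (i + 2) (S j).
Proof.
  intros Hi Hj.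
  rewrite (is_sum_over_nat_first _ (double_sum i j) (- q ^ j * double_sum (i + 2) (S j))
    (double_sum_by_second i j Hi Hj)).
  - rewrite monomial_0; simpl; rewrite Nat.add_0_r; ring.
  - eapply is_sum_over_ext; [|apply is_sum_over_scal, double_sum_by_second; lia].
    intros s _; rewrite monomial_S.
    replace (i + 2 * S s)%nat with (i + 2 + 2 * s)%nat by lia; ring.
Qed.

Lemma triple_sum_by_third i j k :
  (1 <= i)%nat -> (1 <= j)%nat -> (1 <= k)%nat ->
  is_sum_over every
    (fun t => monomial k t * double_sum (i + 2 * t) (j + 2 * t)) (triple_sum i j k).
Proof.
  intros Hi Hj Hk; apply (is_sum_over_snd (term3 i j k));
      [now apply is_triple_sum|].
  intros t; eapply is_sum_over_ext; [|apply is_sum_over_scal, is_double_sum; lia].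
  intros [r s] _; unfold term3, term2; cbn [fst snd]; rewrite !monomial_shift.
  replace (2 * ((r + s) * t))%nat with (2 * t * r + 2 * t * s)%nat by lia.
  rewrite Cpow_add_r; ring.
Qed.

(** The terms with third index 0 form a double sum.  In the others the index is
    lowered by 1: the two cross terms then raise the exponents of the first two
    arguments by 2, and the binomial coefficient that of the third by 1. *)
Lemma triple_sum_shift i j k :
  (1 <= i)%nat -> (1 <= j)%nat -> (1 <= k)%nat ->
  triple_sum i j k = double_sum i j - q ^ k * triple_sum (i + 2) (j + 2) (S k).
Proof.
  intros Hi Hj Hk.
  rewrite (is_sum_over_nat_first _ (triple_sum i j k)
      (- q ^ k * triple_sum (i + 2) (j + 2) (S k))
    (triple_sum_by_third i j k Hi Hj Hk)).
  - rewrite monomial_0; simpl; rewrite !Nat.add_0_r; ring.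
  - eapply is_sum_over_ext; [|apply is_sum_over_scal, triple_sum_by_third; lia].
    intros t _; rewrite monomial_S.
    replace (i + 2 * S t)%nat with (i + 2 + 2 * t)%nat by lia.
    replace (j + 2 * S t)%nat with (j + 2 + 2 * t)%nat by lia; ring.
Qed.

(** All that is left of the first two indices once the triple sum is summed over
    the third, which interacts with them only through [r + s = R]. *)
Definition degree_coef (i j R : nat) : C :=
  bsum (fun r => term2 i j (r, R - r)%nat) (S R).

Lemma double_sum_by_total i j :
  (1 <= i)%nat -> (1 <= j)%nat -> is_sum_over every (degree_coef i j) (double_sum i j).
Proof. intros Hi Hj;
  now apply (is_sum_over_antidiagonal (term2 i j)), is_double_sum. Qed.

(** By [monomial_shift] the sum over the last index is a partial theta function
    that depends only on the sum of the other two. *)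
Lemma triple_sum_by_total i j k :
  (1 <= i)%nat -> (1 <= j)%nat -> (1 <= k)%nat ->
  is_sum_over every (fun R => degree_coef i j R * theta (k + 2 * R)) (triple_sum i j k).
Proof.
  intros Hi Hj Hk.
  assert (H : is_sum_over every
    (fun p => term2 i j p * theta (k + 2 * (fst p + snd p))) (triple_sum i j k)).
  { apply (is_sum_over_fst (term3 i j k)); [now apply is_triple_sum|].
    intros [r s]; eapply is_sum_over_ext;
      [|apply is_sum_over_scal, is_theta; lia].
    intros t _; unfold term3; cbn [fst snd]; rewrite monomial_shift.
    replace (2 * ((r + s) * t))%nat with (2 * (r + s) * t)%nat by lia; ring. }
  apply is_sum_over_antidiagonal in H.
  eapply is_sum_over_ext; [|exact H].
  intros R _; unfold degree_coef; rewrite Cmult_comm, <- bsum_scal.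
  apply bsum_ext; intros r Hr; cbn [fst snd].
  replace (r + (R - r))%nat with R by lia; ring.
Qed.

(** Since [tri (r + s) = tri r + tri s + r * s], only one of the two cross terms
    [r * s] survives next to [tri R]. *)
Lemma degree_coef_eq j d R :
  degree_coef (j + d) j R
  = sgn R * q ^ (tri R + j * R) * bsum (fun r => q ^ (r * (R - r) + d * r)) (S R).
Proof.
  unfold degree_coef; rewrite <- bsum_scal; apply bsum_ext; intros r Hr.
  unfold term2, monomial, sgn; cbn [fst snd].
  assert (E : exists s, (R = r + s)%nat) by (exists (R - r)%nat; lia).
  destruct E as [s ->]; replace (r + s - r)%nat with s by lia.
  replace (tri (r + s)) with (tri r + tri s + r * s)%nat.
  2: { pose proof (tri_double r); pose proof (tri_double s);
       pose proof (tri_double (r + s)); nia. }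
  replace (2 * (r * s))%nat with (r * s + r * s)%nat by lia.
  rewrite !Nat.mul_add_distr_r, !Nat.mul_add_distr_l, !Cpow_add_r; ring.
Qed.

Lemma degree_coef_diag j R :
  degree_coef j j R = sgn R * q ^ (tri R + j * R) * inner (S R).
Proof.
  rewrite <- (Nat.add_0_r j) at 1; rewrite degree_coef_eq; f_equal.
  apply bsum_ext; intros r Hr; f_equal.
  replace (S R - 1 - r)%nat with (R - r)%nat by lia; lia.
Qed.

Lemma degree_coef_offdiag j R :
  degree_coef (S j) j R = sgn R * q ^ (tri R + j * R) * (1 + q ^ R * inner R).
Proof.
  rewrite <- (Nat.add_1_r j), degree_coef_eq; f_equal.
  replace (1 + q ^ R * inner R) with (inner (S (S R)) - 1)
    by (rewrite inner_rec; ring).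
  unfold inner; rewrite (bsum_S _ (S R)).
  replace (S (S R) - 1 - S R)%nat with 0%nat by lia; rewrite Nat.mul_0_r.
  match goal with |- ?x = _ => replace x with (x + 1 - 1) at 1 by ring end.
  f_equal; f_equal; apply bsum_ext; intros r Hr; f_equal.
  replace (S (S R) - 1 - r)%nat with (S (R - r)) by lia; lia.
Qed.

(** The coefficients [ecoef] folded at 0 and at -1/2, according to the symmetry
    of the even and of the odd rows. *)
Definition even_coef (R : nat) : C :=
  ecoef (Z.of_nat R) +
  match R with O => RtoC 0 | S _ => ecoef (- Z.of_nat R) end.

Definition odd_coef (R : nat) : C :=
  ecoef (Z.of_nat R) + ecoef (-1 - Z.of_nat R).

Lemma even_coef_bound : exists K, (0 <= K)%R /\
  forall R, (Cmod (even_coef R) <= K * rho ^ R)%R.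
Proof.
  destruct ecoef_bound as [K [HK0 HK]]; exists (2 * K)%R; split; [lra|].
  intros R; unfold even_coef.
  eapply Rle_trans; [apply Cmod_triangle|].
  pose proof (proj1 (HK R)); destruct R as [|R].
  - rewrite Cmod_0; simpl in *; lra.
  - replace (- Z.of_nat (S R))%Z with (-1 - Z.of_nat R)%Z by lia.
    pose proof (proj2 (HK R)); lra.
Qed.

Lemma odd_coef_bound : exists K, (0 <= K)%R /\
  forall R, (Cmod (odd_coef R) <= K * rho ^ R)%R.
Proof.
  destruct ecoef_bound as [K [HK0 HK]]; exists (2 * K)%R; split; [lra|].
  intros R; unfold odd_coef.
  eapply Rle_trans; [apply Cmod_triangle|].
  destruct (HK R) as [H1 H2]; pose proof (rho_pow_S_le R).
  pose proof rho_range; pose proof (rho_pow_range R).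
  assert (rho ^ S R <= rho ^ R)%R by nra; nra.
Qed.

Lemma even_bailey_pair n :
  bsum (fun R => even_coef R * inv_pair (2 * R) (n - R)) (S n)
      = qfact n * inv_qfact (2 * n).
Proof.
  rewrite <- finite_even, conv_fold_even; apply bsum_ext; intros R HR.
  f_equal; unfold even_coef; f_equal; [f_equal; lia|].
  destruct R; auto; f_equal; lia.
Qed.

Lemma odd_bailey_pair n :
  bsum (fun R => odd_coef R * inv_pair (2 * R + 1) (n - R)) (S n)
  = qfact n * inv_qfact (2 * n + 1).
Proof.
  rewrite <- finite_odd, conv_fold_odd; apply bsum_ext; intros R HR.
  f_equal; unfold odd_coef; f_equal; f_equal; lia.
Qed.

Lemma even_coef_sum : is_sum_over every even_coef (J * J).
Proof.
  destruct even_coef_bound as [K [HK0 HK]].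
  rewrite <- (Cmult_1_r (J * J)), <- J_mult_W at 1.
  apply (bailey_limit even_coef (fun n => qfact n * inv_qfact (2 * n)) _ K); auto.
  - apply even_bailey_pair.
  - apply tends_mult; auto.
    apply (tends_subseq inv_qfact W (fun n => 2 * n)%nat); auto; intros; lia.
Qed.

(** The negative half of [ecoef] is the double sum at [(q^3, q^3)], the image of
    the one at [(q, q)] under [n -> -1-n]; it starts at [-2] because [ecoef]
    vanishes at [-1]. *)
Lemma ecoef_opp_SS R :
  ecoef (- Z.of_nat (S (S R))) = - q ^ 2 * degree_coef 3 3 R.
Proof.
  replace (- Z.of_nat (S (S R)))%Z with (-1 - Z.of_nat (S R))%Z by lia.
  rewrite ecoef_neg, degree_coef_diag, sgn_S; qring.
Qed.

Lemma ecoef_opp_1 : ecoef (- Z.of_nat 1) = 0.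
Proof. change (- Z.of_nat 1)%Z
  with (-1 - Z.of_nat 0)%Z; rewrite ecoef_neg, inner_0; ring. Qed.

Lemma is_sum_over_even_coef (u : nat -> C) l m :
  is_sum_over every (fun R => ecoef (Z.of_nat R) * u R) l ->
  is_sum_over every (fun R => ecoef (- Z.of_nat (S (S R))) * u (S (S R))) m ->
  is_sum_over every (fun R => even_coef R * u R) (l + m).
Proof.
  intros Hl Hm.
  set (f := fun R => match R with O => RtoC 0
    | S _ => ecoef (- Z.of_nat R) * u R end).
  assert (Hf : is_sum_over every f m).
  { apply is_sum_over_nat_shift; [reflexivity|].
    apply is_sum_over_nat_shift; [|exact Hm].
    unfold f; rewrite ecoef_opp_1; ring. }
  eapply is_sum_over_ext; [|apply (is_sum_over_plus _ _ _ _ _ Hl Hf)].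
  intros R _; cbv beta; unfold f, even_coef; destruct R; ring.
Qed.

(** Hecke's double sum for the square of the infinite product, with the part over
    negative indices reflected. *)
Lemma double_sum_identity : double_sum 1 1 - q ^ 2 * double_sum 3 3 = J * J.
Proof.
  apply (is_sum_over_unique every even_coef); [|apply even_coef_sum].
  apply (is_sum_over_ext every (fun R => even_coef R * 1)); [intros; ring|].
  replace (double_sum 1 1 - _)
      with (double_sum 1 1 + - q ^ 2 * double_sum 3 3) by ring.
  apply (is_sum_over_even_coef (fun _ => RtoC 1)).
  - eapply is_sum_over_ext; [|apply (double_sum_by_total 1 1); lia].
    intros R _; cbv beta; rewrite degree_coef_diag, ecoef_nonneg; qring.
  - eapply is_sum_over_ext; [|apply is_sum_over_scal, (double_sum_by_total 3 3);
      lia].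
    intros R _; cbv beta; rewrite ecoef_opp_SS; ring.
Qed.

Lemma qfact_add n m : qfact (n + m) = qfact n * qpoch q (q ^ (n + 1)) m.
Proof.
  induction m as [|m IH].
  - rewrite Nat.add_0_r; unfold qpoch; simpl; ring.
  - rewrite Nat.add_succ_r, qfact_S, IH.
    change (qpoch q (q ^ (n + 1)) (S m))
      with (qpoch q (q ^ (n + 1)) m * (1 - q ^ m * q ^ (n + 1))).
    replace (q ^ S (n + m)) with (q ^ m * q ^ (n + 1)); [ring|].
    rewrite <- Cpow_add_r; f_equal; lia.
Qed.

Lemma qpoch_inv n m : / qpoch q (q ^ (n + 1)) m = qfact n * inv_qfact (n + m).
Proof.
  assert (H : qpoch q (q ^ (n + 1)) m <> 0).
  { intros E; apply (qfact_neq_0 (n + m)); rewrite qfact_add, E; ring. }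
  unfold inv_qfact; rewrite qfact_add; field; auto using qfact_neq_0.
Qed.

(** The two triple sums contribute the nonnegative and the negative half of
    [ecoef]. *)
Lemma chi0_triple_sum :
  exists chi0, is_chi0 q chi0 /\
      triple_sum 2 2 1 - q ^ 4 * triple_sum 4 4 5 = J * J * chi0.
Proof.
  destruct even_coef_bound as [K [HK0 HK]].
  destruct (bailey_transform even_coef 0 K HK0 HK) as [L [HL1 HL2]].
  exists L; split.
  - apply is_series_of_sum.
    eapply is_sum_over_ext; [|exact HL1].
    intros n _; simpl.
    transitivity (q ^ n * (qfact n * inv_qfact (2 * n))).
    + rewrite <- even_bailey_pair; f_equal; apply bsum_ext; intros R _.
      now rewrite Nat.add_0_r.
    + unfold Cdiv; rewrite qpoch_inv; do 3 f_equal; lia.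
  - eapply is_sum_over_unique; [|exact HL2].
    apply (is_sum_over_ext every
      (fun R => even_coef R * (q ^ R * theta (2 * R + 0 + 1)))); [intros; ring|].
    replace (triple_sum 2 2 1 - _)
        with (triple_sum 2 2 1 + - q ^ 4 * triple_sum 4 4 5) by ring.
    apply (is_sum_over_even_coef (fun R => q ^ R * theta (2 * R + 0 + 1))).
    + eapply is_sum_over_ext; [|apply (triple_sum_by_total 2 2 1); lia].
      intros R _; cbv beta; rewrite degree_coef_diag, ecoef_nonneg.
      replace (2 * R + 0 + 1)%nat with (1 + 2 * R)%nat by lia.
      rewrite Cmult_assoc; f_equal; qring.
    + eapply is_sum_over_ext;
        [|apply is_sum_over_scal, (triple_sum_by_total 4 4 5); lia].
      intros R _; cbv beta;
          rewrite degree_coef_diag, ecoef_opp_SS, degree_coef_diag.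
      replace (2 * S (S R) + 0 + 1)%nat with (5 + 2 * R)%nat by lia.
      rewrite !Cmult_assoc; f_equal; qring.
Qed.

(** Here the exponents of the collected indices differ by 1, and the coefficients
    of the two triple sums do not match the two halves of [ecoef] separately,
    only their total. *)
Lemma chi1_triple_sum :
  exists chi1, is_chi1 q chi1 /\
      triple_sum 3 2 2 - q ^ 2 * triple_sum 4 3 4 = J * J * chi1.
Proof.
  destruct odd_coef_bound as [K [HK0 HK]].
  destruct (bailey_transform odd_coef 1 K HK0 HK) as [L [HL1 HL2]].
  exists L; split.
  - apply is_series_of_sum.
    eapply is_sum_over_ext; [|exact HL1].
    intros n _; cbv beta; rewrite odd_bailey_pair.
    unfold Cdiv; rewrite qpoch_inv; do 3 f_equal; lia.
  - eapply is_sum_over_unique; [|exact HL2].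
    replace (triple_sum 3 2 2 - _)
        with (triple_sum 3 2 2 + - q ^ 2 * triple_sum 4 3 4) by ring.
    (* Up to a common factor, the first triple sum has the coefficients
       [C R = 1 + q^R * inner R = inner (R + 2) - 1] and the second, moved by one,
       the coefficients [C (R - 1)]; their sum is [inner (S R) + q^R * inner R]. *)
    set (f := fun R =>
      sgn R * q ^ tri (S R) * (inner (S R) - 1) * q ^ R * theta (2 * R + 1 + 1)).
    assert (Hf : is_sum_over every f (- q ^ 2 * triple_sum 4 3 4)).
    { apply is_sum_over_nat_shift; [unfold f; rewrite inner_1; ring|].
      eapply is_sum_over_ext;
        [|apply is_sum_over_scal, (triple_sum_by_total 4 3 4); lia].
      intros R _; cbv beta; unfold f; rewrite degree_coef_offdiag, inner_rec, sgn_S.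
      replace (2 * S R + 1 + 1)%nat with (4 + 2 * R)%nat by lia.
      rewrite !Cmult_assoc; f_equal; qring. }
    eapply is_sum_over_ext;
      [|apply is_sum_over_plus; [apply (triple_sum_by_total 3 2 2); lia|exact Hf]].
    intros R _; cbv beta; unfold f, odd_coef.
    rewrite degree_coef_offdiag, ecoef_nonneg, ecoef_neg.
    replace (2 * R + 1 + 1)%nat with (2 + 2 * R)%nat by lia.
    rewrite <- Cmult_plus_distr_r; f_equal; qring.
Qed.

End QSeries.

(** * Both octants *)

Lemma Cpowz_nat (z : C) n : Cpowz z (Z.of_nat n) = z ^ n.
Proof.
  destruct n as [|n]; [reflexivity|].
  simpl Z.of_nat; unfold Cpowz; now rewrite SuccNat2Pos.id_succ.
Qed.

Lemma Cpowz_sub (z : C) a b :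
  z <> 0 -> Cpowz z (Z.of_nat a - Z.of_nat b) = z ^ a * / z ^ b.
Proof.
  intros Hz; destruct (Nat.le_ge_cases b a) as [H|H].
  - replace (Z.of_nat a - Z.of_nat b)%Z with (Z.of_nat (a - b)) by lia.
    rewrite Cpowz_nat; replace a with (a - b + b)%nat at 2 by lia.
    rewrite Cpow_add_r; field; auto using Cpow_nz.
  - destruct (Nat.eq_dec a b) as [->|Hne].
    + rewrite Z.sub_diag; change (Cpowz z 0) with (RtoC 1).
      field; auto using Cpow_nz.
    + replace (Z.of_nat a - Z.of_nat b)%Z with (Z.neg (Pos.of_nat (b - a))) by lia.
      unfold Cpowz; rewrite Nat2Pos.id by lia.
      replace b with (b - a + a)%nat at 2 by lia.
      rewrite Cpow_add_r; field; auto using Cpow_nz.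
Qed.

Lemma Z_as_difference (n : Z) : exists a b, n = (Z.of_nat a - Z.of_nat b)%Z.
Proof. exists (Z.to_nat n), (Z.to_nat (- n)); lia. Qed.

Lemma Cpowz_add (z : C) m n : z <> 0 -> Cpowz z (m + n) = Cpowz z m * Cpowz z n.
Proof.
  intros Hz.
  destruct (Z_as_difference m) as [a [b ->]].
  destruct (Z_as_difference n) as [a' [b' ->]].
  replace (_ + _)%Z with (Z.of_nat (a + a') - Z.of_nat (b + b'))%Z by lia.
  rewrite !Cpowz_sub, !Cpow_add_r by auto.
  field; auto using Cpow_nz.
Qed.

Lemma Cpowz_pow (z : C) i n :
  z <> 0 -> Cpowz (z ^ i) n = Cpowz z (Z.of_nat i * n).
Proof.
  intros Hz; destruct (Z_as_difference n) as [a [b ->]].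
  replace (Z.of_nat i * _)%Z with (Z.of_nat (i * a) - Z.of_nat (i * b))%Z by lia.
  rewrite !Cpowz_sub, !Cpow_mult_r by auto using Cpow_nz; reflexivity.
Qed.

Lemma sgn_involutive n : sgn n * sgn n = 1.
Proof.
  unfold sgn; induction n as [|n IH]; [simpl; ring|].
  rewrite Cpow_S; replace (_ * _) with ((- RtoC 1) ^ n * (- RtoC 1) ^ n) by ring.
  exact IH.
Qed.

Lemma binom2_double n : (2 * binom2 n = n * (n - 1))%Z.
Proof.
  unfold binom2; symmetry; apply Z.div_exact; [lia|].
  destruct (Z.Even_or_Odd n) as [[m ->]|[m ->]].
  - replace (2 * m * (2 * m - 1))%Z with (m * (2 * m - 1) * 2)%Z by ring.
    apply Z.mod_mul; lia.
  - replace ((2 * m + 1) * (2 * m + 1 - 1))%Z with ((2 * m + 1) * m * 2)%Z by ring.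
    apply Z.mod_mul; lia.
Qed.

Lemma binom2_nat n : binom2 (Z.of_nat n) = Z.of_nat (tri n).
Proof.
  pose proof (binom2_double (Z.of_nat n)); pose proof (tri_double n); nia.
Qed.

Lemma binom2_neg n : binom2 (-1 - Z.of_nat n)
  = (Z.of_nat (tri n) + 2 * Z.of_nat n + 1)%Z.
Proof.
  pose proof (binom2_double (-1 - Z.of_nat n)); pose proof (tri_double n); nia.
Qed.

Lemma g_term_pow (q : C) i j k r s t :
  q <> 0 ->
  g_term 1 2 1 2 2 1 (q ^ i) (q ^ j) (q ^ k) q (r, s, t)
  = Cpowz (- RtoC 1) (r + s + t) *
    Cpowz q (Z.of_nat i * r + Z.of_nat j * s + Z.of_nat k * t +
      (binom2 r + binom2 s + binom2 t + 2 * (r * s + r * t + s * t))).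
Proof.
  intros Hq; unfold g_term; rewrite !Cpowz_pow by auto.
  rewrite <- !Cmult_assoc; f_equal.
  rewrite <- !Cpowz_add by auto; f_equal; ring.
Qed.

Lemma term3_eq (q : C) i j k r s t :
  term3 q i j k (r, s, t) = sgn (r + s + t) * q ^ (i * r + j * s + k * t +
    (tri r + tri s + tri t + 2 * (r * s + r * t + s * t))).
Proof.
  unfold term3, term2, monomial, sgn; cbn [fst snd].
  rewrite !Nat.mul_add_distr_l, !Nat.mul_add_distr_r, !Nat.mul_add_distr_l.
  rewrite !Cpow_add_r; ring.
Qed.

Lemma g_term_nonneg (q : C) i j k r s t :
  q <> 0 ->
  g_term 1 2 1 2 2 1 (q ^ i) (q ^ j) (q ^ k) q
    (Z.of_nat r, Z.of_nat s, Z.of_nat t)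
  = term3 q i j k (r, s, t).
Proof.
  intros Hq; rewrite g_term_pow, term3_eq, !binom2_nat by auto; unfold sgn.
  rewrite <- !Cpowz_nat; f_equal; f_equal; lia.
Qed.

(** For one index, [binom2 (-1-n) = tri n + 2 n + 1]; the cross terms yield
    [2 (r + s + 1)] for each pair, hence 4 more of each index and 6 in all. *)
Lemma g_term_neg (q : C) i j k i' j' k' c r s t :
  q <> 0 -> (i + i' = 6)%nat -> (j + j' = 6)%nat -> (k + k' = 6)%nat ->
  (c + (i + j + k) = 9)%nat ->
  g_term 1 2 1 2 2 1 (q ^ i) (q ^ j) (q ^ k) q
    (-1 - Z.of_nat r, -1 - Z.of_nat s, -1 - Z.of_nat t)%Z
  = - q ^ c * term3 q i' j' k' (r, s, t).
Proof.
  intros Hq Hi Hj Hk Hc; rewrite g_term_pow, term3_eq, !binom2_neg by auto.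
  replace (-1 - Z.of_nat r + (-1 - Z.of_nat s) + (-1 - Z.of_nat t))%Z
    with (Z.of_nat 0 - Z.of_nat (3 + (r + s + t)))%Z by lia.
  assert (Hm : - RtoC 1 <> 0).
  { intros E; apply (Cmod_gt_0 (- RtoC 1)); auto; rewrite Cmod_m1; lra. }
  rewrite Cpowz_sub by auto; fold (sgn (3 + (r + s + t))).
  replace (/ sgn (3 + (r + s + t))) with (sgn (3 + (r + s + t))).
  2: { pose proof (sgn_involutive (3 + (r + s + t))) as H2.
       assert (sgn (3 + (r + s + t)) <> 0) by now apply Cpow_nz.
       apply (Cmult_cancel_l (sgn (3 + (r + s + t)))); auto.
       rewrite H2; field; auto. }
  set (E := (i' * r + j' * s + k' * t +
    (tri r + tri s + tri t + 2 * (r * s + r * t + s * t)))%nat).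
  match goal with |- _ * Cpowz q ?e = _ => replace e with (Z.of_nat (c + E)) end.
  2: { unfold E; replace i with (6 - i')%nat by lia.
       replace j with (6 - j')%nat by lia; replace k with (6 - k')%nat by lia.
       rewrite !Nat2Z.inj_sub by lia.
       replace c with (9 - (6 - i' + (6 - j') + (6 - k')))%nat by lia.
       rewrite !Nat2Z.inj_add, !Nat2Z.inj_mul, !Nat2Z.inj_add, !Nat2Z.inj_mul.
       rewrite Nat2Z.inj_sub by lia.
       rewrite !Nat2Z.inj_add, !Nat2Z.inj_sub by lia; ring. }
  rewrite Cpowz_nat, Cpow_add_r; unfold sgn; rewrite Cpow_add_r; ring.
Qed.

Lemma is_g_octants (q x y z : C) i j k i' j' k' c :
  q <> 0 -> (Cmod q < 1)%R -> x = q ^ i -> y = q ^ j -> z = q ^ k ->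
  (1 <= i < 6)%nat -> (1 <= j < 6)%nat -> (1 <= k < 6)%nat ->
  (i + i' = 6)%nat -> (j + j' = 6)%nat -> (k + k' = 6)%nat ->
  (c + (i + j + k) = 9)%nat ->
  is_g 1 2 1 2 2 1 x y z q (triple_sum q i j k - q ^ c * triple_sum q i' j' k').
Proof.
  intros Hq hq -> -> -> Hi Hj Hk Hi' Hj' Hk' Hc.
  exists (triple_sum q i j k), (- q ^ c * triple_sum q i' j' k'); split; [|split;
      [|ring]].
  - apply (is_sum_over_reindex (fun p : nat * nat * nat =>
      (Z.of_nat (fst (fst p)), Z.of_nat (snd (fst p)), Z.of_nat (snd p)))).
    + intros [[a b] d] [[a' b'] d']; cbn [fst snd]; intros H.
      injection H; intros; repeat f_equal; lia.
    + intros [[a b] d]; cbn; lia.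
    + intros [[a b] d] [H1 [H2 H3]]; left.
      exists (Z.to_nat a, Z.to_nat b, Z.to_nat d); cbn [fst snd].
      now rewrite !Z2Nat.id.
    + eapply is_sum_over_ext; [|apply (is_triple_sum q hq i j k); lia].
      intros [[r s] t] _; cbn [fst snd]; symmetry; now apply g_term_nonneg.
  - apply (is_sum_over_reindex (fun p : nat * nat * nat =>
      (-1 - Z.of_nat (fst (fst p)), -1 - Z.of_nat (snd (fst p)),
       -1 - Z.of_nat (snd p))%Z)).
    + intros [[a b] d] [[a' b'] d']; cbn [fst snd]; intros H.
      apply pair_equal_spec in H; destruct H as [H Hd].
      apply pair_equal_spec in H; destruct H as [Ha Hb].
      repeat f_equal; lia.
    + intros [[a b] d]; unfold octant_neg; cbn [fst snd]; lia.
    + intros [[a b] d] [H1 [H2 H3]]; left.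
      exists (Z.to_nat (-1 - a), Z.to_nat (-1 - b), Z.to_nat (-1 - d)).
      cbn [fst snd]; f_equal; [f_equal|]; lia.
    + eapply is_sum_over_ext;
        [|apply is_sum_over_scal, (is_triple_sum q hq i' j' k'); lia].
      intros [[r s] t] _; cbn [fst snd]; symmetry; now apply g_term_neg.
Qed.

Theorem corollary1p1 :
  forall q : C, q <> RtoC 0 -> (Cmod q < 1)%R ->
  exists J1 chi0 chi1 : C,
    is_J 1 q J1 /\ is_chi0 q chi0 /\ is_chi1 q chi1 /\
    is_g 1 2 1 2 2 1 (q ^ 3) (q ^ 3) (q ^ 3) q (RtoC 0) /\
    is_g 1 2 1 2 2 1 q q (q ^ 2) q (J1 ^ 2) /\
    is_g 1 2 1 2 2 1 q (q ^ 2) (q ^ 2) q (J1 ^ 2 * chi0) /\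
    is_g 1 2 1 2 2 1 q q (q ^ 3) q (J1 ^ 2 * (q * chi0 + RtoC 1 - q)) /\
    is_g 1 2 1 2 2 1 q (q ^ 2) (q ^ 3) q (J1 ^ 2 * (q * chi1 + RtoC 1)).
Proof.
  intros q Hq hq.
  destruct (tends_qfact q hq) as [J hJ]; destruct (tends_inv_qfact q hq) as [W hW].
  destruct (chi0_triple_sum q hq J W hJ hW) as [chi0 [Hchi0 H0]].
  destruct (chi1_triple_sum q hq J W hJ hW) as [chi1 [Hchi1 H1]].
  pose proof (double_sum_identity q hq J W hJ hW) as HF.
  pose proof (double_sum_shift q hq 1 1 ltac:(lia) ltac:(lia)) as F11.
  pose proof (double_sum_shift q hq 1 2 ltac:(lia) ltac:(lia)) as F12.
  pose proof (triple_sum_shift q hq) as GS.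
  pose proof (GS 1 1 2 ltac:(lia) ltac:(lia) ltac:(lia))%nat as G112.
  pose proof (GS 1 1 3 ltac:(lia) ltac:(lia) ltac:(lia))%nat as G113.
  pose proof (GS 1 2 2 ltac:(lia) ltac:(lia) ltac:(lia))%nat as G122.
  pose proof (GS 1 2 3 ltac:(lia) ltac:(lia) ltac:(lia))%nat as G123.
  pose proof (GS 3 3 3 ltac:(lia) ltac:(lia) ltac:(lia))%nat as G333.
  pose proof (GS 3 3 2 ltac:(lia) ltac:(lia) ltac:(lia))%nat as G332.
  pose proof (GS 3 2 3 ltac:(lia) ltac:(lia) ltac:(lia))%nat as G323.
  pose proof (GS 3 2 2 ltac:(lia) ltac:(lia) ltac:(lia))%nat as G322.
  cbn [Nat.add] in *; clear GS.
  rewrite (triple_sum_swap23 q hq 2 2 1), (triple_sum_swap12 q hq 2 1 2) in H0 by lia.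
  rewrite (triple_sum_swap23 q hq 4 4 5), (triple_sum_swap12 q hq 4 5 4) in H0 by lia.
  rewrite (triple_sum_swap12 q hq 4 3 4) in H1 by lia.
  exists J, chi0, chi1.
  split; [|split; [exact Hchi0|split; [exact Hchi1|]]].
  { apply tends_filterlim.
    eapply tends_ext; [|exact hJ]; intros n.
    induction n as [|n IH]; [reflexivity|].
    rewrite qfact_S, IH; simpl (Cprod _ (S n)); now rewrite Nat.add_0_r. }
  assert (E1 : q = q ^ 1) by ring.
  split; [|split; [|split; [|split]]].
  - replace (RtoC 0) with (triple_sum q 3 3 3 - q ^ 0 * triple_sum q 3 3 3) by ring.
    apply is_g_octants; auto; lia.
  - replace (J ^ 2) with (triple_sum q 1 1 2 - q ^ 5 * triple_sum q 5 5 4).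
    + apply (is_g_octants q q q (q ^ 2)); auto; lia.
    + replace (J ^ 2) with (J * J) by ring.
      rewrite <- HF, G112, G333; ring.
  - replace (J ^ 2 * chi0) with (triple_sum q 1 2 2 - q ^ 4 * triple_sum q 5 4 4).
    + apply (is_g_octants q q (q ^ 2) (q ^ 2)); auto; lia.
    + rewrite H0; ring.
  - replace (J ^ 2 * (q * chi0 + RtoC 1 - q))
      with (triple_sum q 1 1 3 - q ^ 4 * triple_sum q 5 5 3).
    + apply (is_g_octants q q q (q ^ 3)); auto; lia.
    + replace (J ^ 2 * (q * chi0 + RtoC 1 - q))
        with (q * (J * J * chi0) + (1 - q) * (J * J)) by ring.
      rewrite <- H0, <- HF, G113, G122, (triple_sum_swap23 q hq 3 4 3) by lia.
      assert (E : q ^ 3 * triple_sum q 5 4 4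
          = double_sum q 3 2 - triple_sum q 3 3 2).
      { rewrite (triple_sum_swap23 q hq 3 3 2), G323 by lia; ring. }
      replace (q ^ 4 * triple_sum q 5 4 4)
          with (q * (q ^ 3 * triple_sum q 5 4 4)) by ring.
      rewrite E, F12, F11, G332; ring.
  - replace (J ^ 2 * (q * chi1 + RtoC 1))
      with (triple_sum q 1 2 3 - q ^ 3 * triple_sum q 5 4 3).
    + apply (is_g_octants q q (q ^ 2) (q ^ 3)); auto; lia.
    + replace (J ^ 2 * (q * chi1 + RtoC 1))
        with (q * (J * J * chi1) + J * J) by ring.
      rewrite <- H1, <- HF, G123, G322, F12, F11; ring.
Qed.
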